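(* Let $\Gamma$ be a finite subgroup of $\mathbf{SL}_3(\mathbb{C})$. Then the coordinates of the vector $P_\Gamma(t,u)\in(\mathbb{C}[[t,u]])^{l+1}$ are rational fractions in $t$ and $u$; that is, for every $i\in\{0,\dots,l\}$ the formal power series of the multiplicities $P_\Gamma(t,u)_i=\sum_{m=0}^\infty\sum_{n=0}^\infty m_i(m,n)\,t^m u^n$ is a rational function of $t$ and $u$ (i.e. the power series expansion of an element of $\mathbb{C}(t,u)$).
   Context: $\gamma_0,\dots,\gamma_l$ are representatives of the equivalence classes of irreducible finite-dimensional complex representations of $\Gamma$, with $\gamma_0$ trivial. Let $\varpi_1,\varpi_2$ be the fundamental weights of $\mathfrak{sl}_3(\mathbb{C})$ (with $\varpi_1$ the highest weight of the natural representation $\mathbb{C}^3$), and for $(m,n)\in\mathbb{N}^2$ let $\pi_{m,n}:\mathbf{SL}_3(\mathbb{C})\to\mathbf{GL}(V(m\varpi_1+n\varpi_2))$ be the irreducible representation of highest weight $m\varpi_1+n\varpi_2$. The non-negative integers $m_i(m,n)$ are the multiplicities defined by $\pi_{m,n}|_\Gamma=\bigoplus_{i=0}^l m_i(m,n)\,\gamma_i$. With $(e_0,\dots,e_l)$ the canonical basis of $\mathbb{C}^{l+1}$, set $v_{m,n}=\sum_{i=0}^l m_i(m,n)e_i$ and $P_\Gamma(t,u)=\sum_{m,n\ge 0}v_{m,n}t^mu^n$; $P_\Gamma(t,u)_i$ is its coordinate along $e_i$. Here $\mathbb{N}$ contains $0$. *)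

(* Defs.v *)
From mathcomp Require Import all_boot all_order all_algebra all_fingroup.
From mathcomp Require Import mxrepresentation character.
From mathcomp Require Import fraction.
From mathcomp Require mpoly.

Set Implicit Arguments.
Unset Strict Implicit.
Unset Printing Implicit Defensive.

Import GRing.Theory.

Local Open Scope ring_scope.

Section SpecialLinear3.

Variable F : fieldType.

Definition SL3 : {pred 'M[F]_3} := [pred g | \det g == 1].

(* [f] is a regular function on SL_3: the restriction of a polynomial in the
   nine matrix entries. *)
Definition regular_on_SL3 (f : 'M[F]_3 -> F) : Prop :=
  exists p : mpoly.mpoly (3 * 3) F,
    {in SL3, forall g, f g = mpoly.meval (fun k => mxvec g 0 k) p}.

(* A finite-dimensional algebraic representation SL_3 -> GL_d, acting on
   column vectors by left multiplication.  The values of [SL3_fun] outside SL3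
   are irrelevant; its values on SL3 are invertible because those of a monoid
   morphism on a group are. *)
Record SL3_rep : Type := SL3Rep {
  SL3_dim : nat;
  SL3_fun :> 'M[F]_3 -> 'M[F]_SL3_dim;
  SL3_fun1 : SL3_fun 1%:M = 1%:M;
  SL3_funM : {in SL3 &, forall g h, SL3_fun (g *m h) = SL3_fun g *m SL3_fun h};
  SL3_fun_regular : forall i j, regular_on_SL3 (fun g => SL3_fun g i j)
}.

Definition SL3_stable (pi : SL3_rep) (W : {vspace 'cV[F]_(SL3_dim pi)}) : Prop :=
  {in SL3, forall g, {in W, forall w, pi g *m w \in W}}.

Definition SL3_irreducible (pi : SL3_rep) : Prop :=
  (0 < SL3_dim pi)%N /\
  (forall W : {vspace 'cV[F]_(SL3_dim pi)},
     SL3_stable W -> W = 0%VS \/ W = fullv).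

(* The Borel subgroup is that of upper triangular matrices ([is_trig_mx] means
   lower triangular, whence the transpose); the maximal torus is that of
   diagonal matrices. *)
Definition unipotent_upper (g : 'M[F]_3) : Prop :=
  is_trig_mx g^T /\ (forall i, g i i = 1).

(* The characters of the diagonal torus given by the fundamental weights:
   diag(a,b,c) |-> a is the highest weight of the natural representation and
   diag(a,b,c) |-> ab that of its exterior square, i.e. of its dual. *)
Definition varpi1 (g : 'M[F]_3) : F := g (inord 0) (inord 0).
Definition varpi2 (g : 'M[F]_3) : F :=
  g (inord 0) (inord 0) * g (inord 1) (inord 1).

(* There is a highest weight vector of weight m varpi1 + n varpi2: a nonzero
   weight vector of that weight fixed by the unipotent radical of the Borel
   subgroup. *)
Definition has_highest_weight (pi : SL3_rep) (m n : nat) : Prop :=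
  exists v : 'cV[F]_(SL3_dim pi),
    [/\ v != 0,
        {in SL3, forall g, unipotent_upper g -> pi g *m v = v} &
        {in SL3, forall g, is_diag_mx g ->
           pi g *m v = (varpi1 g ^+ m * varpi2 g ^+ n) *: v}].

Section Restriction.

Variables (gT : finGroupType) (G : {group gT}).
Variable iota : mx_representation F G 3.
Hypothesis iota_SL3 : {in G, forall x, iota x \in SL3}.

Lemma SL3_restr_mx_repr (pi : SL3_rep) : mx_repr G (fun x => pi (iota x)).
Proof.
split=> [|x y Gx Gy]; first by rewrite repr_mx1 SL3_fun1.
by rewrite repr_mxM // SL3_funM // iota_SL3.
Qed.

(* pi|_G, for G embedded in SL_3 by iota *)
Definition SL3_restr (pi : SL3_rep) : mx_representation F G (SL3_dim pi) :=
  MxRepresentation (SL3_restr_mx_repr pi).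

End Restriction.

End SpecialLinear3.

Arguments SL3 : clear implicits.

Section IrreducibleRepresentatives.

Variables (F : fieldType) (gT : finGroupType) (G : {group gT}).

Definition irr_representatives (l : nat)
    (gamma : 'I_l.+1 -> representation F G) : Prop :=
  [/\ forall i, mx_irreducible (gamma i),
      forall i j, mx_rsim (gamma i) (gamma j) -> i = j &
      forall (d : nat) (rho : mx_representation F G d),
        mx_irreducible rho -> exists i, mx_rsim rho (gamma i)].

Definition trivial_representation (rho : representation F G) : Prop :=
  rdegree rho = 1%N /\ {in G, forall x, rho x = 1%:M}.

(* The external direct sum of k i copies of gamma i. *)
Definition isotypic_sum (l : nat) (gamma : 'I_l.+1 -> representation F G)
    (k : 'I_l.+1 -> nat) : representation F G :=
  \big[dadd_grepr/grepr0]_(i < l.+1) muln_grepr (gamma i) (k i).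

End IrreducibleRepresentatives.

Section PowerSeries.

Variable F : fieldType.

(* The formal power series \sum_(m, n) f m n t^m u^n, as its coefficients. *)
Definition series2 (A : Type) : Type := nat -> nat -> A.

(* F[t,u] as F[u][t]: the coefficient of t^m u^n in p is p`_m`_n. *)
Definition poly_series (p : {poly {poly F}}) : series2 F := fun m n => p`_m`_n.

Definition series2_mul (f g : series2 F) : series2 F := fun m n =>
  \sum_(i < m.+1) \sum_(j < n.+1) f i j * g (m - i)%N (n - j)%N.

(* f is the expansion at the origin of the element r of the fraction field
   F(t,u) of F[t,u]: r = p / q with q(0,0) != 0, so that q is invertible in
   F[[t,u]], and f = p q^-1 there. *)
Definition expansion (r : {fraction {poly {poly F}}}) (f : series2 F) : Prop :=
  exists p q : {poly {poly F}},
    [/\ q`_0`_0 != 0,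
        r = (tofrac p) / (tofrac q) &
        forall m n, series2_mul (poly_series q) f m n = poly_series p m n].

Definition rational_series (f : series2 F) : Prop :=
  exists r : {fraction {poly {poly F}}}, expansion r f.

(* v_{m,n} = \sum_i mult m n i e_i in F^(l+1) *)
Definition mult_vector (l : nat) (mult : nat -> nat -> 'I_l.+1 -> nat)
    (m n : nat) : 'rV[F]_l.+1 :=
  \sum_(i < l.+1) (mult m n i)%:R *: delta_mx 0 i.

Definition P_series (l : nat) (mult : nat -> nat -> 'I_l.+1 -> nat) :
  series2 'rV[F]_l.+1 := fun m n => mult_vector mult m n.

Definition coord_series (l : nat) (f : series2 'rV[F]_l.+1) (i : 'I_l.+1) :
  series2 F := fun m n => f m n 0 i.

End PowerSeries.

(* Main.v *)
Require Import Defs.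
From mathcomp Require Import all_boot all_order all_algebra all_fingroup.
From mathcomp Require Import mxrepresentation character.
From mathcomp Require Import fraction complex reals.
From mathcomp Require Import pgroup separable cyclotomic mpoly ring zify.
From mathcomp Require boolp.

(* Write the multiplicity of gamma i as a linear combination, independent of
   (m, n), of the traces of pi m n on Gamma; an element of Gamma is conjugate
   in SL_3 to a diagonal matrix d, so it is enough to show that the traces of
   the pi m n at d have a rational generating function.
   For g in SL_3 let x(g) be the first column of g and y(g) the vector of minors
   of its first two columns, so that x(g).y(g) = 0.  With v a highest weight
   vector, some linear form phi satisfies
     phi (pi g v) = x0(g)^m y2(g)^n =: D(g) for all g:
   this holds on the big cell for the leading coefficient along a one-parameter
   subgroup, and extends by density.  By irreducibility a combination
   sum_k c_k pi(g_k) v vanishes iff sum_k c_k D(h g_k) = 0 for all h.  Since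
   D(g^* h) = <x(g), x(h)>^m <y(g), y(h)>^n is a positive kernel, this means that
   sum_k c_k f(g_k) = 0 for all monomials f of bidegree (m, n) in x and y.  So
   the dual of pi m n has the basis of those monomials that are not divisible by
   x2 y2, on which d acts diagonally, and the trace at d is the sum of the
   weights of these monomials, a combination of products of complete
   homogeneous symmetric polynomials. *)

Set Implicit Arguments.
Unset Strict Implicit.
Unset Printing Implicit Defensive.

Import Order.TTheory GRing.Theory Num.Theory.

Local Open Scope ring_scope.

(** * Rational double series *)

Section RationalSeries.

Variable F : fieldType.
Implicit Types (p q : {poly {poly F}}) (f g : series2 F).

Lemma series2_mulD (q : series2 F) f g m n :
  series2_mul q (fun i j => f i j + g i j) m n =
  series2_mul q f m n + series2_mul q g m n.
Proof.
rewrite -big_split; apply: eq_bigr => i _; rewrite -big_split.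
by apply: eq_bigr => j _; rewrite mulrDr.
Qed.

Lemma series2_mulZ (q : series2 F) a f m n :
  series2_mul q (fun i j => a * f i j) m n = a * series2_mul q f m n.
Proof.
rewrite mulr_sumr; apply: eq_bigr => i _; rewrite mulr_sumr.
by apply: eq_bigr => j _; rewrite mulrCA.
Qed.

Lemma eq_series2_mul (q : series2 F) f g m n :
    (forall i j, i <= m -> j <= n -> f i j = g i j)%N ->
  series2_mul q f m n = series2_mul q g m n.
Proof.
move=> eq_fg; apply: eq_bigr => i _; apply: eq_bigr => j _.
by rewrite eq_fg // leq_subr.
Qed.

Lemma poly_seriesM p q m n :
  series2_mul (poly_series p) (poly_series q) m n = poly_series (p * q) m n.
Proof.
rewrite /poly_series coefM coef_sum; apply: eq_bigr => i _.
by rewrite coefM.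
Qed.

Definition truncation N f : {poly {poly F}} :=
  \poly_(i < N) \poly_(j < N) f i j.

Lemma poly_series_truncation N f m n :
  (m < N)%N -> (n < N)%N -> poly_series (truncation N f) m n = f m n.
Proof. by move=> lt_mN lt_nN; rewrite /poly_series !coef_poly lt_mN coef_poly lt_nN. Qed.

(** The coefficient at (m, n) involves [f] only up to (m, n), so [f] may be replaced by a polynomial
    truncation, and associativity becomes that of the polynomial ring. *)
Lemma series2_mulA p q f m n :
  series2_mul (poly_series (p * q)) f m n =
  series2_mul (poly_series p) (series2_mul (poly_series q) f) m n.
Proof.
pose N := (m + n).+1; pose T := truncation N f.
have fT i j : (i <= m -> j <= n -> f i j = poly_series T i j)%N.
  move=> le_im le_jn; rewrite poly_series_truncation // ltnS.
    exact: leq_trans le_im (leq_addr _ _).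
  exact: leq_trans le_jn (leq_addl _ _).
rewrite (eq_series2_mul _ fT) poly_seriesM -mulrA -poly_seriesM.
apply: eq_series2_mul => i j le_im le_jn; rewrite -poly_seriesM.
by apply: eq_series2_mul => i' j' le_i' le_j'; rewrite fT //;
  apply: leq_trans; eassumption.
Qed.

Lemma rational_seriesP f :
  rational_series f <->
  exists p q, q`_0`_0 != 0 /\
    forall m n, series2_mul (poly_series q) f m n = poly_series p m n.
Proof.
split=> [[r [p [q [q0 _ qf]]]] | [p [q [q0 qf]]]]; first by exists p, q.
by exists (tofrac p / tofrac q), p, q.
Qed.

Lemma eq_rational_series f g :
  (forall m n, f m n = g m n) -> rational_series f -> rational_series g.
Proof.
move=> eq_fg /rational_seriesP[p [q [q0 qf]]].
apply/rational_seriesP; exists p, q; split=> // m n; rewrite -qf.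
by apply: eq_series2_mul => i j _ _; rewrite eq_fg.
Qed.

Lemma rational_seriesD f g :
  rational_series f -> rational_series g ->
  rational_series (fun m n => f m n + g m n).
Proof.
move=> /rational_seriesP[p [q [q0 qf]]] /rational_seriesP[p' [q' [q'0 q'g]]].
apply/rational_seriesP; exists (q' * p + q * p'), (q * q'); split=> [|m n].
  by rewrite coef0M coef0M mulf_neq0.
rewrite series2_mulD {1}(mulrC q) !series2_mulA.
rewrite (eq_series2_mul _ (fun i j _ _ => qf i j)).
rewrite (eq_series2_mul _ (fun i j _ _ => q'g i j)).
by rewrite !poly_seriesM /poly_series !coefD.
Qed.

Lemma rational_seriesZ a f :
  rational_series f -> rational_series (fun m n => a * f m n).
Proof.
move=> /rational_seriesP[p [q [q0 qf]]].
apply/rational_seriesP; exists (a%:P *: p), q; split=> // m n.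
by rewrite series2_mulZ qf /poly_series coefZ coefCM.
Qed.

Lemma rational_series0 : rational_series (fun _ _ => 0 : F).
Proof.
apply/rational_seriesP; exists 0, 1; rewrite !coefC !eqxx oner_neq0.
split=> // m n; rewrite /poly_series !coef0.
by apply: big1 => i _; apply: big1 => j _; rewrite mulr0.
Qed.

Lemma rational_series_sum (I : Type) (s : seq I) (P : pred I)
    (f : I -> series2 F) :
    (forall i, P i -> rational_series (f i)) ->
  rational_series (fun m n => \sum_(i <- s | P i) f i m n).
Proof.
move=> rat_f; elim: s => [|i s IHs].
  by apply: eq_rational_series rational_series0 => m n; rewrite big_nil.
case Pi: (P i); last first.
  by apply: eq_rational_series IHs => m n; rewrite big_cons Pi.
apply: eq_rational_series (rational_seriesD (rat_f i Pi) IHs) => m n.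
by rewrite big_cons Pi.
Qed.

Lemma rational_series1 : rational_series (fun m n => ((m == 0) && (n == 0))%:R : F)%N.
Proof.
apply/rational_seriesP; exists 1, 1; rewrite !coefC !eqxx oner_neq0.
split=> // m n.
have eq1 i j : ((i == 0) && (j == 0))%:R = poly_series 1 i j :> F.
  by rewrite /poly_series coefC; case: eqP; rewrite ?coef0 // coefC; case: eqP.
by rewrite (eq_series2_mul _ (fun i j _ _ => eq1 i j)) poly_seriesM mulr1.
Qed.

(** A denominator of [g] times [p] is a denominator of [f], its constant term being a product of two
    nonzero ones. *)
Lemma rational_series_quotient p f g :
    p`_0`_0 != 0 ->
    (forall m n, series2_mul (poly_series p) f m n = g m n) ->
  rational_series g -> rational_series f.
Proof.
move=> p0 pf /rational_seriesP[r [q [q0 qg]]].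
apply/rational_seriesP; exists r, (q * p); split=> [|m n].
  by rewrite coef0M coef0M mulf_neq0.
by rewrite series2_mulA -qg; apply: eq_series2_mul => i j _ _.
Qed.

(** The outer variable of F[u][t] is t, so the multiplier is 1 - a t. *)
Lemma series2_mul_t a f m n :
  series2_mul (poly_series (1 - a%:P *: 'X)) f m n =
  f m n - (if m is m'.+1 then a * f m' n else 0).
Proof.
rewrite /series2_mul /poly_series big_ord_recl big_ord_recl /= !subn0.
rewrite coefB coefC coefZ coefX /= mulr0 subr0 coefC mul1r.
rewrite [X in _ + X + _]big1 ?addr0 => [|j _]; last by rewrite coefC mul0r.
congr (_ + _); case: m => [|m]; first by rewrite big_ord0 oppr0.
rewrite big_ord_recl big_ord_recl /= !subn0 subn1 /=.
rewrite coefB coefC coefZ coefX /= mulr1 sub0r coefN coefC mulNr.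
rewrite [X in _ + X + _]big1 ?addr0 => [|j _]; last first.
  by rewrite coefN coefC oppr0 mul0r.
rewrite big1 ?addr0 // => i _; apply: big1 => j _.
by rewrite coefB coefC coefZ coefX /= mulr0 subr0 coef0 mul0r.
Qed.

(** The multiplier is 1 - a u, a constant polynomial in t. *)
Lemma series2_mul_u a f m n :
  series2_mul (poly_series (1 - a *: 'X)%:P) f m n =
  f m n - (if n is n'.+1 then a * f m n' else 0).
Proof.
rewrite /series2_mul /poly_series big_ord_recl [X in _ + X]big1 ?addr0; last first.
  by move=> i _; apply: big1 => j _; rewrite coefC coef0 mul0r.
rewrite coefC /= !subn0 big_ord_recl /= subn0.
rewrite coefB coefC coefZ coefX /= mulr0 subr0 mul1r.
congr (_ + _); case: n => [|n]; first by rewrite big_ord0 oppr0.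
rewrite big_ord_recl /= subn1 /=.
rewrite coefB coefC coefZ coefX /= mulr1 sub0r mulNr.
rewrite big1 ?addr0 // => j _.
by rewrite coefB coefC coefZ coefX /= mulr0 subr0 mul0r.
Qed.

(** The complete homogeneous symmetric polynomial of degree n at the entries of [s]: the coefficient
    of t^n in the product of the 1 / (1 - a t). *)
Fixpoint complete_sym (s : seq F) (n : nat) : F :=
  if s is a :: s' then \sum_(i < n.+1) a ^+ i * complete_sym s' (n - i)
  else (n == 0)%:R.

Lemma complete_symS a s n :
  complete_sym (a :: s) n.+1 =
  complete_sym s n.+1 + a * complete_sym (a :: s) n.
Proof.
rewrite /= big_ord_recl expr0 mul1r subn0 mulr_sumr; congr (_ + _).
by apply: eq_bigr => i _; rewrite exprS mulrA.
Qed.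

(** The series is the product of all 1 / (1 - a t), a in [s], and 1 / (1 - b u), b in [s']. By
    [complete_symS], multiplying by one of these denominators deletes its entry from the list. *)
Lemma complete_sym_rational s s' :
  rational_series (fun m n => complete_sym s m * complete_sym s' n).
Proof.
elim: s => [|a s IHs].
  elim: s' => [|a s' IHs'].
    by apply: eq_rational_series rational_series1 => m n; rewrite -natrM mulnb.
  apply: (rational_series_quotient (p := (1 - a *: 'X)%:P)) IHs' => [|m n].
    by rewrite coefC coefB coefC coefZ coefX mulr0 subr0 oner_neq0.
  rewrite series2_mul_u; case: n => [|n].
    by rewrite /= big_ord_recl big_ord0 subr0 addr0 mul1r.
  by rewrite complete_symS mulrDr mulrCA addrK.
apply: (rational_series_quotient (p := 1 - a%:P *: 'X)) IHs => [|m n].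
  by rewrite coefB coefC coefZ coefX mulr0 subr0 coefC oner_neq0.
rewrite series2_mul_t; case: m => [|m].
  by rewrite /= big_ord_recl big_ord0 subr0 addr0 mul1r.
by rewrite complete_symS mulrDl mulrA addrK.
Qed.

End RationalSeries.

(** * Multiplicities from traces, diagonalization *)

Section Multiplicities.

Variables (C : numClosedFieldType) (gT : finGroupType) (G : {group gT}).

Lemma numField_pchar'_group : ([pchar C]^'.-group G)%g.
Proof.
by apply/pgroupP=> p p_pr _; rewrite inE /= (pchar_num C).
Qed.

Lemma mxtrace_dsum_grepr (I : Type) (r : seq I) (P : pred I)
    (rho : I -> representation C G) x :
  \tr ((\big[dadd_grepr/grepr0]_(i <- r | P i) rho i) x) =
  \sum_(i <- r | P i) \tr (rho i x).
Proof.
elim: r => [|i r IHr]; first by rewrite !big_nil /= mxtrace1.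
by rewrite !big_cons; case: (P i); rewrite //= mxtrace_block IHr.
Qed.

Lemma mxtrace_isotypic_sum l (gamma : 'I_l.+1 -> representation C G) k x :
  \tr (isotypic_sum gamma k x) = \sum_i \tr (gamma i x) *+ k i.
Proof.
rewrite mxtrace_dsum_grepr; apply: eq_bigr => i _.
by rewrite mxtrace_dsum_grepr sumr_const card_ord.
Qed.

(* The coefficients are those of the central idempotent of the group algebra
   that acts as the identity on gamma i and as 0 on the other gamma j. *)
Lemma multiplicity_mxtrace l (gamma : 'I_l.+1 -> representation C G) i :
    irr_representatives gamma ->
  exists c : gT -> C, forall n (rho : mx_representation C G n) k,
    mx_rsim rho (isotypic_sum gamma k) ->
  (k i)%:R = \sum_(x in G) c x * \tr (rho x).
Proof.
move=> [irr_gamma inj_gamma _]; have C'G := numField_pchar'_group.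
pose sG : irrType C G := DecSocleType (regular_repr C G).
pose comp j := irr_comp sG (gamma j).
have rsim_comp j := rsim_irr_comp_pchar sG C'G (irr_gamma j).
have comp_inj j : comp j = comp i -> j = i.
  move=> eq_ji; apply: inj_gamma; apply: mx_rsim_trans (rsim_comp j) _.
  by apply: mx_rsim_sym; rewrite -/(comp j) eq_ji; apply: rsim_comp.
have e_mem := Wedderburn_id_mem (comp i).
have op_ne j : j != i -> gring_op (gamma j) (Wedderburn_id (comp i)) = 0.
  move=> ne_ji; apply: (irr_comp'_op0_pchar C'G (irr_gamma j)) e_mem.
  by apply: contraNneq ne_ji => /esym/comp_inj ->.
have op_i : gring_op (gamma i) (Wedderburn_id (comp i)) = 1%:M.
  (* The identity is the sum of these idempotents over all components, and only that of [comp i]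
     survives on [gamma i]. *)
  rewrite -(gring_op1 (gamma i)) -(Wedderburn_sum_id_pchar sG C'G) linear_sum.
  rewrite (bigD1 (comp i)) //= big1 ?addr0 // => j ne_ji.
  exact: (irr_comp'_op0_pchar C'G (irr_gamma i) ne_ji (Wedderburn_id_mem _)).
have: (Wedderburn_id (comp i) \in group_ring C G)%MS.
  by rewrite -(Wedderburn_sum_pchar sG C'G) (sumsmx_sup (comp i)).
case/envelop_mxP=> a def_e; rewrite def_e in op_ne op_i.
have op_tr j : \tr (gring_op (gamma j) (\sum_(x in G) a x *: regular_repr C G x))
    = \sum_(x in G) a x * \tr (gamma j x).
  rewrite !linear_sum; apply: eq_bigr => x Gx.
  by rewrite !linearZ /= gring_opG.
have d_neq0 : (rdegree (gamma i))%:R != 0 :> C.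
  by case/mx_irrP: (irr_gamma i) => d_gt0 _; rewrite pnatr_eq0 -lt0n.
(* The idempotent has trace [k i] times the degree of [gamma i] on rho, whence the division by the
   degree. *)
exists (fun x => (rdegree (gamma i))%:R^-1 * a x) => n rho k rsim_rho.
transitivity ((rdegree (gamma i))%:R^-1 * \sum_(x in G) a x * \tr (rho x)).
  apply: (mulfI d_neq0); rewrite mulVKf //.
  transitivity (\sum_j (\sum_(x in G) a x * \tr (gamma j x)) *+ k j).
    rewrite (bigD1 i) //= [X in _ + X]big1 => [|j ne_ji].
      by rewrite addr0 -op_tr op_i mxtrace1 mulr_natr.
    by rewrite -op_tr op_ne // linear0 mul0rn.
  rewrite (eq_bigr _ (fun j _ => esym (sumrMnl _ _ _ _))) exchange_big /=.
  apply: eq_bigr => x Gx; rewrite (mxtrace_rsim rsim_rho Gx).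
  rewrite mxtrace_isotypic_sum mulr_sumr; apply: eq_bigr => j _.
  by rewrite mulrnAr.
by rewrite mulr_sumr; apply: eq_bigr => x _; rewrite mulrA.
Qed.

(** The polynomial X^N - 1, with N the order of x, annihilates [rho x], splits, and has simple roots
    in characteristic 0. *)
Lemma diagonalizable_repr n (rho : mx_representation C G n.+1) x :
  x \in G -> diagonalizable (rho x).
Proof.
move=> Gx; pose N := #[x]%g; have N_gt0 : (0 < N)%N := order_gt0 x.
apply/diagonalizableP.
have [rs def_rs] := closed_field_poly_normal ('X^N - 1 : {poly C}).
move: def_rs; rewrite lead_coefXnsubC // scale1r => def_rs.
exists rs.
  rewrite -separable_prod_XsubC -def_rs separable_Xn_sub_1 //.
  by rewrite pnatr_eq0 -lt0n.
rewrite -def_rs mxminpoly_min // rmorphB rmorph1 rmorphXn /= horner_mx_X.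
apply/eqP; rewrite subr_eq0; apply/eqP; move: (rho) => rG.
have rG_X k : rG x ^+ k = rG (x ^+ k)%g.
  elim: k => [|k IHk]; rewrite ?expr0 ?expg0 ?repr_mx1 //.
  by rewrite exprS expgS repr_mxM ?groupX // IHk.
by rewrite rG_X expg_order repr_mx1.
Qed.

Lemma diagonalizable_SL3 (A : 'M[C]_3) :
    diagonalizable A ->
  exists2 S, S \in SL3 C & exists d : 'rV_3, A *m S = S *m diag_mx d.
Proof.
move=> [P uP /(diagonalizable_forLR uP)[d def_A]].
(* Scaling the matrix [invmx P] by a cube root of det P makes its determinant 1. *)
pose c : C := 3.-root (\det P).
exists (c *: invmx P).
  by rewrite inE detZ det_inv rootCK // divrr //.
exists d; rewrite def_A mxpoly.conjVmx // -scalemxAr -scalemxAl; congr (_ *: _).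
by rewrite mulmxK.
Qed.

End Multiplicities.

(** * The highest weight functional *)

Local Notation i0 := (@ord0 2).
Local Notation i1 := (lift (@ord0 2) (@ord0 1)).
Local Notation i2 := (@ord_max 2).

Section SL3Elements.

Variable C : numClosedFieldType.
Implicit Types (g h : 'M[C]_3) (p q w : {poly C}).


Lemma ord3P (P : 'I_3 -> Prop) : P i0 -> P i1 -> P i2 -> forall i, P i.
Proof.
move=> P0 P1 P2 [[|[|[|i]]] lti] //.
- by rewrite (_ : Ordinal lti = i0) //; apply: val_inj.
- by rewrite (_ : Ordinal lti = i1) //; apply: val_inj.
- by rewrite (_ : Ordinal lti = i2) //; apply: val_inj.
Qed.

Lemma sum_ord3 (V : nmodType) (f : 'I_3 -> V) :
  \sum_i f i = f i0 + f i1 + f i2.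
Proof.
rewrite !big_ord_recl big_ord0 addr0 addrA; congr (_ + f _ + f _);
  exact: val_inj.
Qed.

Lemma inord3 : (inord 0 = i0 :> 'I_3) * (inord 1 = i1 :> 'I_3).
Proof. by split; apply: val_inj; rewrite /= inordK. Qed.

Definition mx3 (R : nmodType) (a b c d e f g h i : R) : 'M[R]_3 :=
  \matrix_(u < 3, v < 3)
    nth 0 (nth [::] [:: [:: a; b; c]; [:: d; e; f]; [:: g; h; i]] u) v.

Lemma det_mx33 (R : comPzRingType) (A : 'M[R]_3) :
  \det A = A i0 i0 * (A i1 i1 * A i2 i2 - A i1 i2 * A i2 i1)
         - A i0 i1 * (A i1 i0 * A i2 i2 - A i1 i2 * A i2 i0)
         + A i0 i2 * (A i1 i0 * A i2 i1 - A i1 i1 * A i2 i0).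
Proof.
rewrite (expand_det_row A i0) sum_ord3 /cofactor !(expand_det_row _ ord0).
rewrite !big_ord_recl !big_ord0 /cofactor !det_mx11 !mxE /=.
have e02 : lift i0 (lift (@ord0 1) (@ord0 0)) = i2 by apply: val_inj.
have e01 : lift i0 (lift (lift (@ord0 1) (@ord0 0)) (@ord0 0)) = i1 by apply: val_inj.
have e10 : lift i1 (@ord0 1) = i0 by apply: val_inj.
have e12 : lift i1 (lift (@ord0 1) (@ord0 0)) = i2 by apply: val_inj.
have e10' : lift i1 (lift (lift (@ord0 1) (@ord0 0)) (@ord0 0)) = i0 by apply: val_inj.
have e20 : lift i2 (@ord0 1) = i0 by apply: val_inj.
have e21 : lift i2 (lift (@ord0 1) (@ord0 0)) = i1 by apply: val_inj.
have e20' : lift i2 (lift (lift (@ord0 1) (@ord0 0)) (@ord0 0)) = i0 by apply: val_inj.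
rewrite e02 e01 e10 e12 e10' e20 e21 e20' /bump /=; ring.
Qed.

Definition xcol g (i : 'I_3) : C := g i i0.

(** The cross product of the first two columns. *)
Definition ymin g (i : 'I_3) : C :=
  nth 0 [:: g i1 i0 * g i2 i1 - g i2 i0 * g i1 i1;
            g i2 i0 * g i0 i1 - g i0 i0 * g i2 i1;
            g i0 i0 * g i1 i1 - g i1 i0 * g i0 i1] i.

(** The product of powers of the first two leading principal minors: the matrix coefficient of a
    highest weight vector against a suitable functional. *)
Definition hw_function m n g : C := xcol g i0 ^+ m * ymin g i2 ^+ n.

Lemma xcol_ymin g : \sum_i xcol g i * ymin g i = 0.
Proof. by rewrite sum_ord3 /xcol /ymin /=; ring. Qed.

Lemma xcol_neq0 g : g \in SL3 C -> exists i, xcol g i != 0.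
Proof.
move=> /eqP det_g; apply/existsP; apply: contraT => /existsPn x0.
have {}x0 i : g i i0 = 0 by apply/eqP; move: (x0 i); rewrite negbK.
by have /eqP := oner_neq0 C; case; rewrite -det_g det_mx33 !x0; ring.
Qed.

Lemma ymin_neq0 g : g \in SL3 C -> exists i, ymin g i != 0.
Proof.
move=> /eqP det_g; apply/existsP; apply: contraT => /existsPn y0.
have {}y0 i : ymin g i = 0 by apply/eqP; move: (y0 i); rewrite negbK.
have /eqP := oner_neq0 C; case; rewrite -det_g det_mx33.
transitivity (ymin g i0 * g i0 i2 + ymin g i1 * g i1 i2 + ymin g i2 * g i2 i2).
  by rewrite /ymin /=; ring.
by rewrite !y0; ring.
Qed.

(* Cauchy-Binet, for the minors of the first two columns. *)
Lemma hw_function_mul_tr m n g h :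
  hw_function m n (g^T *m h) =
  (\sum_i xcol g i * xcol h i) ^+ m * (\sum_i ymin g i * ymin h i) ^+ n.
Proof.
rewrite /hw_function; congr (_ ^+ m * _ ^+ n).
  by rewrite /xcol !mxE; apply: eq_bigr => i _; rewrite mxE.
by rewrite /ymin /= !mxE !sum_ord3 !mxE /=; ring.
Qed.

(** Density of the locus where w is nonzero: w * p vanishes at every natural number, hence at more
    points than its degree allows. *)
Lemma poly_eq0_horner w p :
  w != 0 -> (forall s, w.[s] != 0 -> p.[s] = 0) -> p = 0.
Proof.
move=> w_neq0 p0; apply: contraTeq isT => p_neq0.
have wp_neq0 : w * p != 0 by rewrite mulf_neq0.
pose rs := [seq i%:R : C | i <- iota 0 (size (w * p))].
have rs_roots : all (root (w * p)) rs.
  apply/allP => s _; rewrite rootE hornerM.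
  by have [-> | /p0->] := eqVneq w.[s] 0; rewrite (mul0r, mulr0).
have rs_uniq : uniq rs.
  rewrite map_inj_in_uniq ?iota_uniq // => i j _ _ /eqP.
  by rewrite eqr_nat => /eqP.
have := max_poly_roots wp_neq0 rs_roots rs_uniq.
by rewrite size_map size_iota ltnn.
Qed.

Lemma regular_on_SL3_sum (I : finType) (c : I -> C) (f : I -> 'M[C]_3 -> C) :
    (forall i, regular_on_SL3 (f i)) ->
  regular_on_SL3 (fun g => \sum_i c i * f i g).
Proof.
move=> /fin_all_exists[p def_f].
exists (\sum_i c i *: p i) => g SLg.
rewrite raddf_sum; apply: eq_bigr => i _.
by rewrite /= mevalZ def_f.
Qed.

Lemma regular_on_SL3_coef (pi : SL3_rep C) (l : 'rV_(SL3_dim pi))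
    (v : 'cV_(SL3_dim pi)) :
  regular_on_SL3 (fun g => (l *m pi g *m v) 0 0).
Proof.
have [p def_p] := regular_on_SL3_sum 
  (fun ij : 'I_(SL3_dim pi) * 'I_(SL3_dim pi) => l 0 ij.1 * v ij.2 0)
  (fun ij => @SL3_fun_regular _ pi ij.1 ij.2).
exists p => g SLg; rewrite -def_p // mxE.
under eq_bigr do rewrite mxE mulr_suml.
by rewrite exchange_big pair_big; apply: eq_bigr => ij _; rewrite mulrAC.
Qed.

Lemma meval_poly_curve k (p : {mpoly C[k]}) (c : 'I_k -> {poly C}) :
  exists q, forall s, q.[s] = meval (fun i => (c i).[s]) p.
Proof.
exists (\sum_(m <- msupp p) mcoeff m p *:
  \prod_i c i ^+ fun_of_multinom m i) => s.
rewrite mevalE horner_sum; apply: eq_bigr => m _.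
rewrite hornerZ horner_prod; congr (_ * _).
by apply: eq_bigr => i _; rewrite horner_exp.
Qed.

(** Along a curve c(s) / s, the factor s^N with N at least the degree of p clears the pole at 0. *)
Lemma meval_laurent_curve k (p : {mpoly C[k]}) (c : 'I_k -> {poly C}) N :
    (msize p <= N)%N ->
  exists q, forall s (v : 'I_k -> C), (forall i, s * v i = (c i).[s]) ->
    q.[s] = s ^+ N * meval v p.
Proof.
move=> le_pN; exists (\sum_(m <- msupp p) mcoeff m p *:
  ('X^(N - mdeg m) * \prod_i c i ^+ fun_of_multinom m i)) => s v cv.
rewrite mevalE horner_sum mulr_sumr; apply: eq_big_seq => m p_m.
rewrite hornerZ hornerM hornerXn horner_prod [RHS]mulrCA; congr (_ * _).
have le_mN : (mdeg m <= N)%N.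
  by apply: leq_trans le_pN; apply/ltnW/msize_mdeg_lt.
rewrite -[in RHS](subnK le_mN) exprD -mulrA; congr (_ * _).
rewrite mdegE -prodrXr -big_split /=; apply: eq_bigr => i _.
by rewrite horner_exp -cv exprMn.
Qed.

Lemma SL3M g h : g \in SL3 C -> h \in SL3 C -> g *m h \in SL3 C.
Proof. by rewrite !inE det_mulmx => /eqP-> /eqP->; rewrite mulr1. Qed.

Lemma SL3_tr g : g \in SL3 C -> g^T \in SL3 C.
Proof. by rewrite !inE det_tr. Qed.

Lemma det_mx3 (a b c d e f r s t : C) :
  \det (mx3 a b c d e f r s t) =
  a * (e * t - f * s) - b * (d * t - f * r) + c * (d * s - e * r).
Proof. by rewrite det_mx33 !mxE /=. Qed.

Lemma eq_mx3 (R : Type) (A B : 'M[R]_3) :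
  (A i0 i0 = B i0 i0 /\ A i0 i1 = B i0 i1 /\ A i0 i2 = B i0 i2) ->
  (A i1 i0 = B i1 i0 /\ A i1 i1 = B i1 i1 /\ A i1 i2 = B i1 i2) ->
  (A i2 i0 = B i2 i0 /\ A i2 i1 = B i2 i1 /\ A i2 i2 = B i2 i2) -> A = B.
Proof.
move=> [? [? ?]] [? [? ?]] [? [? ?]]; apply/matrixP.
by apply: ord3P; apply: ord3P.
Qed.

(** The LDU factorization: the diagonal factor consists of quotients of successive leading principal
    minors, the last of which is det g = 1. *)
Lemma big_cell g :
    g \in SL3 C -> xcol g i0 != 0 -> ymin g i2 != 0 ->
  exists l10 l20 l21 u01 u02 u12,
    g = mx3 1 0 0 l10 1 0 l20 l21 1 *m
        (mx3 (xcol g i0) 0 0 0 (ymin g i2 / xcol g i0) 0 0 0 (ymin g i2)^-1 *m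
         mx3 1 u01 u02 0 1 u12 0 0 1).
Proof.
move=> /eqP; rewrite det_mx33 /xcol /ymin /= => det_g a_neq0.
(* The minor is made opaque and [g i1 i1] expressed through it, so that [field] sees independent
   variables with nonzero denominators. *)
have [b def_b] : exists b, b = g i0 i0 * g i1 i1 - g i1 i0 * g i0 i1 by eexists.
rewrite -def_b => b_neq0.
have def_g11 : g i1 i1 = (b + g i1 i0 * g i0 i1) / g i0 i0.
  by rewrite def_b subrK mulrAC mulfV ?mul1r.
exists (g i1 i0 / g i0 i0), (g i2 i0 / g i0 i0).
exists ((g i0 i0 * g i2 i1 - g i2 i0 * g i0 i1) / b).
exists (g i0 i1 / g i0 i0), (g i0 i2 / g i0 i0).
exists ((g i0 i0 * g i1 i2 - g i1 i0 * g i0 i2) / b).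
apply: eq_mx3; rewrite !mxE !sum_ord3 !mxE !sum_ord3 !mxE /= ?def_g11.
- by do 2?split; field; rewrite ?a_neq0 ?b_neq0.
- by do 2?split; field; rewrite ?a_neq0 ?b_neq0.
do 2?split; try by field; rewrite ?a_neq0 ?b_neq0.
(* The last entry is the one that depends on det g = 1: the factor 1 is replaced by the expanded
   determinant. *)
have -> : b^-1 * 1 = b^-1 * (
    g i0 i0 * (g i1 i1 * g i2 i2 - g i1 i2 * g i2 i1) -
    g i0 i1 * (g i1 i0 * g i2 i2 - g i1 i2 * g i2 i0) +
    g i0 i2 * (g i1 i0 * g i2 i1 - g i1 i1 * g i2 i0)) by rewrite det_g.
by rewrite def_g11; field; rewrite a_neq0 b_neq0.
Qed.

Lemma regular_curve (f : 'M[C]_3 -> C) (A : 'M[{poly C}]_3) :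
    regular_on_SL3 f -> (forall s, map_mx (horner_eval s) A \in SL3 C) ->
  exists q, forall s, q.[s] = f (map_mx (horner_eval s) A).
Proof.
move=> [p def_f] SL_A; have [q def_q] := meval_poly_curve p (mxvec A 0).
exists q => s; rewrite def_q def_f //; apply: meval_eq => k.
by rewrite -map_mxvec mxE.
Qed.

End SL3Elements.

(** * Construction of the functional *)

Section HighestWeightFunctional.

Variables (C : numClosedFieldType) (pi : SL3_rep C) (m n : nat)
  (v : 'cV[C]_(SL3_dim pi)).
Hypothesis v_neq0 : v != 0.
Hypothesis v_unip :
  {in SL3 C, forall g, unipotent_upper g -> pi g *m v = v}.
Hypothesis v_diag : {in SL3 C, forall g, is_diag_mx g ->
  pi g *m v = (varpi1 g ^+ m * varpi2 g ^+ n) *: v}.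

Lemma weight_diag a b c : a * b * c = 1 ->
  pi (mx3 a 0 0 0 b 0 0 0 c) *m v = (a ^+ m * (a * b) ^+ n) *: v.
Proof.
move=> abc; rewrite v_diag ?inE ?det_mx3.
- by rewrite /varpi1 /varpi2 !inord3 !mxE.
- by apply/eqP; rewrite -abc; ring.
by apply/is_diag_mxP; apply: ord3P; apply: ord3P; rewrite ?mxE.
Qed.

Lemma unipotent_fix a b c : pi (mx3 1 a b 0 1 c 0 0 1) *m v = v.
Proof.
apply: v_unip; first by rewrite inE det_mx3; apply/eqP; ring.
split; last by apply: ord3P; rewrite mxE.
by apply/is_trig_mxP; apply: ord3P; apply: ord3P; rewrite ?mxE.
Qed.

(* Conjugating the lower unipotent factor of an element of the big cell by
   diag(s^-1, 1, s) contracts it to the identity as s tends to 0; the functional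
   reads off the leading coefficient in s. *)
Lemma hw_functional_big_cell :
  exists phi : 'rV_(SL3_dim pi), {in SL3 C, forall g,
    xcol g i0 != 0 -> ymin g i2 != 0 ->
    (phi *m pi g *m v) 0 0 = hw_function m n g}.
Proof.
have [k vk_neq0] : exists k, v k 0 != 0.
  by move/matrix0Pn: v_neq0 => [k [j]]; rewrite (ord1 j); exists k.
pose phi0 : 'rV[C]_(SL3_dim pi) := (v k 0)^-1 *: delta_mx 0 k.
have phi0v : (phi0 *m v) 0 0 = 1.
  by rewrite -scalemxAl -rowE !mxE mulVf.
pose e j : 'cV[C]_(SL3_dim pi) := delta_mx j 0.
have ex_p j : exists p : {mpoly C[(3 * 3)]},
    {in SL3 C, forall g, (phi0 *m pi g *m e j) 0 0 =
                         meval (fun k => mxvec g 0 k) p}.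
  exact: (regular_on_SL3_coef phi0 (e j)).
have [p def_p] := fin_all_exists ex_p.
(* A single exponent that bounds the size of every [p j]. *)
pose N := (m + n + \sum_j msize (p j))%N.
(* This is s times diag(s^-1, 1, s), free of poles. *)
pose A : 'M[{poly C}]_3 := mx3 1 0 0 0 'X 0 0 0 'X^2.
have ex_q j : exists q, forall s (x : 'I_(3 * 3) -> C),
    (forall i, s * x i = (mxvec A 0 i).[s]) ->
    q.[s] = s ^+ N * meval x (p j).
  apply: meval_laurent_curve; rewrite /N (bigD1 j) //= addnCA.
  exact: leq_addr.
have [q def_q] := fin_all_exists ex_q.
(* As q_j(s) = s^N phi0(pi(diag(s^-1, 1, s)) e_j), this functional sends u to the coefficient of
   s^-(m+n) in phi0(pi(diag(s^-1, 1, s)) u). *)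
exists (\row_j ('X^(m + n) * q j)`_N) => g SLg x_neq0 y_neq0.
have [l10 [l20 [l21 [u01 [u02 [u12 def_g]]]]]] := big_cell SLg x_neq0 y_neq0.
set a := xcol g i0 in x_neq0 def_g *; set b := ymin g i2 in y_neq0 def_g *.
(* The conjugate of the lower unipotent factor by diag(s^-1, 1, s). *)
pose B : 'M[{poly C}]_3 :=
  mx3 1 0 0 (l10 *: 'X) 1 0 (l20 *: 'X^2) (l21 *: 'X) 1.
have B_s s : map_mx (horner_eval s) B =
    mx3 1 0 0 (l10 * s) 1 0 (l20 * s ^+ 2) (l21 * s) 1.
  by apply: eq_mx3; rewrite !mxE /= /horner_eval !hornerE.
have SL_B s : map_mx (horner_eval s) B \in SL3 C.
  by rewrite B_s inE det_mx3; apply/eqP; ring.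
have [Q def_Q] := regular_curve (regular_on_SL3_coef phi0 v) SL_B.
(* For s nonzero, tau g = B(s) (tau D) U, where U fixes v and tau D scales it by s^-(m+n) times
   [hw_function m n g]. *)
have: \sum_j (pi g *m v) j 0 *: ('X^(m + n) * q j) -
      hw_function m n g *: ('X^N * Q) = 0.
  apply: (@poly_eq0_horner C 'X); first by rewrite polyX_eq0.
  move=> s; rewrite hornerX => s_neq0; apply/eqP.
  rewrite hornerD hornerN subr_eq0; apply/eqP.
  rewrite hornerZ hornerM hornerXn def_Q B_s.
  pose tau : 'M[C]_3 := mx3 s^-1 0 0 0 1 0 0 0 s.
  have SLtau : tau \in SL3 C by rewrite inE det_mx3; apply/eqP; field.
  have q_s j : (q j).[s] = s ^+ N * (phi0 *m pi tau *m e j) 0 0.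
    rewrite (def_q _ _ (fun k => mxvec tau 0 k)) => [|i]; first by rewrite def_p.
    have tau_s : map_mx (horner_eval s) A = s *: tau.
      by apply: eq_mx3; rewrite !mxE /= /horner_eval !hornerE; do 2?split; field.
    transitivity (mxvec (s *: tau) 0 i); first by rewrite linearZ mxE.
    by rewrite -tau_s -map_mxvec mxE.
  rewrite horner_sum; transitivity
      (s ^+ (m + n) * s ^+ N * (phi0 *m pi tau *m (pi g *m v)) 0 0).
    rewrite mxE mulr_sumr; apply: eq_bigr => j _.
    rewrite hornerZ hornerM hornerXn q_s -colE [col _ _ _ _]mxE.
    by rewrite mulrC -!mulrA.
  have tau_g : tau *m g = mx3 1 0 0 (l10 * s) 1 0 (l20 * s ^+ 2) (l21 * s) 1 *m
      (mx3 (s^-1 * a) 0 0 0 (b / a) 0 0 0 (s / b) *m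
       mx3 1 u01 u02 0 1 u12 0 0 1).
    rewrite def_g !mulmxA; congr (_ *m _).
    by apply: eq_mx3; rewrite !mxE !sum_ord3 !mxE !sum_ord3 !mxE /=;
      do 2?split; field; rewrite ?s_neq0 ?x_neq0 ?y_neq0.
  have SLT : mx3 (s^-1 * a) 0 0 0 (b / a) 0 0 0 (s / b) \in SL3 C.
    by rewrite inE det_mx3; apply/eqP; field; rewrite s_neq0 x_neq0 y_neq0.
  have SLU : mx3 1 u01 u02 0 1 u12 0 0 1 \in SL3 C.
    by rewrite inE det_mx3; apply/eqP; ring.
  rewrite -mulmxA (mulmxA (pi tau)) -SL3_funM // tau_g.
  rewrite SL3_funM ?SL3M // -?B_s // SL3_funM // -!mulmxA unipotent_fix.
  rewrite weight_diag; last by field; rewrite s_neq0 x_neq0 y_neq0.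
  have -> : s^-1 * a * (b / a) = s^-1 * b by field; rewrite s_neq0 x_neq0.
  rewrite -!scalemxAr mxE /hw_function -/a -/b !exprMn !exprVn exprD.
  rewrite mulmxA; set z := (phi0 *m _ *m v) 0 0.
  move: (expf_neq0 m s_neq0) (expf_neq0 n s_neq0).
  move: (s ^+ m) (s ^+ n) (s ^+ N) (a ^+ m) (b ^+ n) z => S T U V W z S0 T0.
  by field; rewrite S0 T0.
(* In degree N the second term leaves Q(0), which is phi0 v = 1 since B is the identity at s = 0. *)
move/(congr1 (fun P : {poly C} => P`_N)).
rewrite coef0 coefB coefZ coefXnM ltnn subnn coef_sum => /eqP.
rewrite subr_eq0 => /eqP eq_N; transitivity (hw_function m n g * Q`_0).
  rewrite -eq_N -mulmxA mxE; apply: eq_bigr => j _.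
  by rewrite mxE coefZ mulrC.
have B_0 : map_mx (horner_eval 0) B = 1%:M.
  by rewrite B_s; apply: eq_mx3; rewrite !mxE /= ?expr0n ?mulr0.
by rewrite -horner_coef0 def_Q B_0 SL3_fun1 mulmx1 phi0v mulr1.
Qed.

(** Any g is joined to the big cell by a curve U(s) g with U(0) = 1. Both sides are polynomials in s
    that agree wherever U(s) g lies in the big cell, hence also at s = 0. *)
Lemma hw_functional :
  exists phi : 'rV_(SL3_dim pi), {in SL3 C, forall g,
    (phi *m pi g *m v) 0 0 = hw_function m n g}.
Proof.
have [phi def_phi] := hw_functional_big_cell; exists phi => g SLg.
(* On U(s) g, x0 becomes x0 + s x1 + s^2 x2 and y2 becomes y2 - 2 s y1 + s^2 y0. The entry 2 s keeps
   all three y_i present, so neither polynomial is zero. *)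
pose U : 'M[{poly C}]_3 := mx3 1 'X 'X^2 0 1 (2 *: 'X) 0 0 1.
pose A : 'M[{poly C}]_3 := U *m map_mx polyC g.
have U_s s : map_mx (horner_eval s) U = mx3 1 s (s ^+ 2) 0 1 (2 * s) 0 0 1.
  by apply: eq_mx3; rewrite !mxE /= /horner_eval !hornerE.
have A_s s : map_mx (horner_eval s) A = mx3 1 s (s ^+ 2) 0 1 (2 * s) 0 0 1 *m g.
  rewrite map_mxM U_s; congr (_ *m _); apply/matrixP=> i j.
  by rewrite !mxE /= /horner_eval hornerC.
have SL_A s : map_mx (horner_eval s) A \in SL3 C.
  by rewrite A_s SL3M // inE det_mx3; apply/eqP; ring.
have [q def_q] := regular_curve (regular_on_SL3_coef phi v) SL_A.
pose px := (xcol g i0)%:P + xcol g i1 *: 'X + xcol g i2 *: 'X^2.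
pose py := (ymin g i2)%:P - (2 * ymin g i1) *: 'X + ymin g i0 *: 'X^2.
have px_s s : px.[s] = xcol (map_mx (horner_eval s) A) i0.
  by rewrite /px A_s /xcol !mxE sum_ord3 !mxE /= !hornerE /=; ring.
have py_s s : py.[s] = ymin (map_mx (horner_eval s) A) i2.
  by rewrite /py A_s /ymin !mxE !sum_ord3 !mxE /= !hornerE /=; ring.
have quad_neq0 (a b c : C) (P := a%:P + b *: 'X + c *: 'X^2) :
    a != 0 \/ b != 0 \/ c != 0 -> P != 0.
  move=> abc; apply/eqP => P0.
  have := congr1 (fun P : {poly C} => (P`_0, P`_1, P`_2)) P0.
  rewrite !coef0 !coefD !coefZ !coefX !coefXn !coefC /=.
  rewrite !(mulr0, mulr1, addr0, add0r) => -[a0 b0 c0].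
  by case: abc => [|[]]; rewrite ?a0 ?b0 ?c0 eqxx.
have px_neq0 : px != 0.
  apply: quad_neq0; case: (xcol_neq0 SLg) => i.
  by apply: (@ord3P (fun i => xcol g i != 0 -> _)) i; tauto.
have py_neq0 : py != 0.
  rewrite /py -scaleNr; apply: quad_neq0; case: (ymin_neq0 SLg) => i.
  apply: (@ord3P (fun i => ymin g i != 0 -> _)) i; try tauto.
  by move=> y1; right; left; rewrite oppr_eq0 mulf_neq0 // pnatr_eq0.
have q_eq : q = px ^+ m * py ^+ n.
  apply/eqP; rewrite -subr_eq0; apply/eqP.
  apply: (@poly_eq0_horner C (px * py)); first by rewrite mulf_neq0.
  move=> s; rewrite hornerM mulf_eq0 negb_or => /andP[x0 y0].
  rewrite hornerD hornerN hornerM !horner_exp def_q def_phi //; last 2 first.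
  - by rewrite -px_s.
  - by rewrite -py_s.
  by rewrite /hw_function -px_s -py_s subrr.
have A_0 : map_mx (horner_eval 0) A = g.
  rewrite A_s -[RHS]mul1mx; congr (_ *m _).
  by apply: eq_mx3; rewrite !mxE /= ?expr0n ?mulr0.
rewrite -[in LHS]A_0 -def_q q_eq hornerM !horner_exp px_s py_s A_0.
by [].
Qed.

End HighestWeightFunctional.

(** * Monomials on the cone x.y = 0 *)

Section GramForm.

Variables (C : numClosedFieldType) (I : finType) (x y : I -> 'I_3 -> C).
Implicit Type c : I -> C.

(** The squared norm of the sum over k of c_k times the tensor product of p copies of x_k and q
    copies of y_k. *)
Definition gram p q c : C :=
  \sum_j \sum_k (c j)^* * c k *
    ((\sum_i (x j i)^* * x k i) ^+ p * (\sum_i (y j i)^* * y k i) ^+ q).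

Lemma gram_Sl p q c :
  gram p.+1 q c = \sum_i gram p q (fun k => c k * x k i).
Proof.
rewrite /gram [RHS]exchange_big; apply: eq_bigr => j _.
rewrite [RHS]exchange_big; apply: eq_bigr => k _.
rewrite exprS [LHS](_ : _ = (\sum_i (x j i)^* * x k i) * ((c j)^* * c k *
    ((\sum_i (x j i)^* * x k i) ^+ p * (\sum_i (y j i)^* * y k i) ^+ q))).
  by rewrite mulr_suml; apply: eq_bigr => i _; rewrite rmorphM; ring.
by ring.
Qed.

Lemma gram_Sr p q c :
  gram p q.+1 c = \sum_i gram p q (fun k => c k * y k i).
Proof.
rewrite /gram [RHS]exchange_big; apply: eq_bigr => j _.
rewrite [RHS]exchange_big; apply: eq_bigr => k _.
rewrite exprS [LHS](_ : _ = (\sum_i (y j i)^* * y k i) * ((c j)^* * c k *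
    ((\sum_i (x j i)^* * x k i) ^+ p * (\sum_i (y j i)^* * y k i) ^+ q))).
  by rewrite mulr_suml; apply: eq_bigr => i _; rewrite rmorphM; ring.
by ring.
Qed.

Lemma gram00 c : gram 0 0 c = `|\sum_k c k| ^+ 2.
Proof.
rewrite /gram normCK mulrC rmorph_sum mulr_suml; apply: eq_bigr => j _.
by rewrite mulr_sumr; apply: eq_bigr => k _; rewrite !mulr1.
Qed.

Lemma gram_ge0 p q c : 0 <= gram p q c.
Proof.
elim: p c => [|p IHp] c; last first.
  by rewrite gram_Sl; apply: sumr_ge0 => i _; apply: IHp.
elim: q c => [|q IHq] c; last first.
  by rewrite gram_Sr; apply: sumr_ge0 => i _; apply: IHq.
by rewrite gram00 exprn_ge0.
Qed.

(** By [gram_Sl] the form is a sum of nonnegative terms, each of which must vanish; choosing the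
    coordinate [i] each time extracts x_i^a. *)
Lemma gram_eq0_expl i a p q c :
  gram (a + p) q c = 0 -> gram p q (fun k => c k * x k i ^+ a) = 0.
Proof.
elim: a c => [|a IHa] c.
  by move=> <-; congr gram; apply: boolp.funext => k; rewrite mulr1.
rewrite addSn gram_Sl => /eqP; rewrite psumr_eq0 => [|j _]; last exact: gram_ge0.
move=> /allP/(_ i (mem_index_enum i))/eqP/IHa <-.
by congr gram; apply: boolp.funext => k; rewrite exprS mulrA.
Qed.

Lemma gram_eq0_expr i a p q c :
  gram p (a + q) c = 0 -> gram p q (fun k => c k * y k i ^+ a) = 0.
Proof.
elim: a c => [|a IHa] c.
  by move=> <-; congr gram; apply: boolp.funext => k; rewrite mulr1.
rewrite addSn gram_Sr => /eqP; rewrite psumr_eq0 => [|j _]; last exact: gram_ge0.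
move=> /allP/(_ i (mem_index_enum i))/eqP/IHa <-.
by congr gram; apply: boolp.funext => k; rewrite exprS mulrA.
Qed.

End GramForm.

Section Monomials.

Variable C : numClosedFieldType.

Definition bimonomial (x y : 'I_3 -> C) a0 a1 a2 b0 b1 b2 : C :=
  (x i0 ^+ a0 * x i1 ^+ a1 * x i2 ^+ a2) *
  (y i0 ^+ b0 * y i1 ^+ b1 * y i2 ^+ b2).

Section Relations.

Variables (I : finType) (x y : I -> 'I_3 -> C).
Local Notation mon k := (bimonomial (x k) (y k)).

Lemma gram_eq0_bimonomial a0 a1 a2 b0 b1 b2 c :
    gram x y (a0 + a1 + a2) (b0 + b1 + b2) c = 0 ->
  \sum_k c k * mon k a0 a1 a2 b0 b1 b2 = 0.
Proof.
(* The added zeros make the extractions end in bidegree (0, 0), where the form is a squared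
   modulus. *)
rewrite -!addnA -[a2]addn0 -[b2]addn0.
move=> /(gram_eq0_expl i0)/(gram_eq0_expl i1)/(gram_eq0_expl i2).
move=> /(gram_eq0_expr i0)/(gram_eq0_expr i1)/(gram_eq0_expr i2).
rewrite gram00 => /eqP; rewrite expf_eq0 /= normr_eq0 => /eqP sum0.
rewrite -[RHS]sum0; apply: eq_bigr => k _; rewrite /bimonomial !addn0; ring.
Qed.

(** The powers are expanded one linear factor at a time, the coordinate x_i or y_i being absorbed
    into the coefficients [c], over which the inductions generalize. *)
Lemma bimonomial_eq0_hw m n c (u w : 'I_3 -> C) :
    (forall a0 a1 a2 b0 b1 b2, (a0 + a1 + a2 = m)%N -> (b0 + b1 + b2 = n)%N ->
       \sum_k c k * mon k a0 a1 a2 b0 b1 b2 = 0) ->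
  \sum_k c k * ((\sum_i u i * x k i) ^+ m * (\sum_i w i * y k i) ^+ n) = 0.
Proof.
elim: m c => [|m IHm] c mon0; last first.
  transitivity (\sum_i u i * (\sum_k (c k * x k i) *
     ((\sum_i u i * x k i) ^+ m * (\sum_i w i * y k i) ^+ n))).
    under [RHS]eq_bigr do rewrite mulr_sumr.
    rewrite exchange_big; apply: eq_bigr => k _.
    rewrite exprS [LHS](_ : _ = (\sum_i u i * x k i) * (c k * ((\sum_i u i * x k i) ^+ m *
      (\sum_i w i * y k i) ^+ n))).
      by rewrite mulr_suml; apply: eq_bigr => i _; ring.
    by ring.
  apply: big1 => i _; rewrite IHm ?mulr0 // => a0 a1 a2 b0 b1 b2 def_m def_n.
  apply: (@ord3P (fun i =>
    \sum_k c k * x k i * mon k a0 a1 a2 b0 b1 b2 = 0)) i.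
  - rewrite -[RHS](mon0 a0.+1 a1 a2 b0 b1 b2 ltac:(lia) ltac:(lia)).
    by apply: eq_bigr => k _; rewrite /bimonomial exprS; ring.
  - rewrite -[RHS](mon0 a0 a1.+1 a2 b0 b1 b2 ltac:(lia) ltac:(lia)).
    by apply: eq_bigr => k _; rewrite /bimonomial exprS; ring.
  - rewrite -[RHS](mon0 a0 a1 a2.+1 b0 b1 b2 ltac:(lia) ltac:(lia)).
    by apply: eq_bigr => k _; rewrite /bimonomial exprS; ring.
elim: n c mon0 => [|n IHn] c mon0; last first.
  transitivity (\sum_i w i * (\sum_k (c k * y k i) *
     ((\sum_i u i * x k i) ^+ 0 * (\sum_i w i * y k i) ^+ n))).
    under [RHS]eq_bigr do rewrite mulr_sumr.
    rewrite exchange_big; apply: eq_bigr => k _.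
    rewrite exprS [LHS](_ : _ = (\sum_i w i * y k i) * (c k * ((\sum_i u i * x k i) ^+ 0 *
      (\sum_i w i * y k i) ^+ n))).
      by rewrite mulr_suml; apply: eq_bigr => i _; ring.
    by ring.
  apply: big1 => i _; rewrite IHn ?mulr0 // => a0 a1 a2 b0 b1 b2 def_m def_n.
  apply: (@ord3P (fun i =>
    \sum_k c k * y k i * mon k a0 a1 a2 b0 b1 b2 = 0)) i.
  - rewrite -[RHS](mon0 a0 a1 a2 b0.+1 b1 b2 ltac:(lia) ltac:(lia)).
    by apply: eq_bigr => k _; rewrite /bimonomial exprS; ring.
  - rewrite -[RHS](mon0 a0 a1 a2 b0 b1.+1 b2 ltac:(lia) ltac:(lia)).
    by apply: eq_bigr => k _; rewrite /bimonomial exprS; ring.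
  - rewrite -[RHS](mon0 a0 a1 a2 b0 b1 b2.+1 ltac:(lia) ltac:(lia)).
    by apply: eq_bigr => k _; rewrite /bimonomial exprS; ring.
rewrite -[RHS](mon0 0 0 0 0 0 0)%N //; apply: eq_bigr => k _.
by rewrite /bimonomial !expr0 !mulr1.
Qed.

(** On the cone, x2 y2 = - x0 y0 - x1 y1 lowers the exponents of x2 and y2 until one is zero. *)
Lemma bimonomial_eq0_reduced m n c :
    (forall k, \sum_i x k i * y k i = 0) ->
    (forall a0 a1 a2 b0 b1 b2, (a0 + a1 + a2 = m)%N -> (b0 + b1 + b2 = n)%N ->
       (a2 = 0 \/ b2 = 0)%N -> \sum_k c k * mon k a0 a1 a2 b0 b1 b2 = 0) ->
  forall a0 a1 a2 b0 b1 b2, (a0 + a1 + a2 = m)%N -> (b0 + b1 + b2 = n)%N ->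
       \sum_k c k * mon k a0 a1 a2 b0 b1 b2 = 0.
Proof.
move=> xy0 mon0 a0 a1 a2; elim: a2 a0 a1 => [|a2 IHa] a0 a1 b0 b1 [|b2] ha hb.
- by apply: mon0; auto.
- by apply: mon0; auto.
- by apply: mon0; auto.
transitivity (- (\sum_k c k * mon k a0.+1 a1 a2 b0.+1 b1 b2)
              - \sum_k c k * mon k a0 a1.+1 a2 b0 b1.+1 b2); last first.
  by rewrite !IHa ?oppr0 ?addr0 //; lia.
rewrite -!sumrN -big_split; apply: eq_bigr => k _ /=.
have := xy0 k; rewrite sum_ord3 => /(canRL (addKr _)); rewrite addr0 => xy2.
transitivity (c k * mon k a0 a1 a2 b0 b1 b2 * (x k i2 * y k i2)).
  by rewrite /bimonomial !exprS; ring.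
by rewrite xy2 /bimonomial !exprS; ring.
Qed.

End Relations.

(** Extraction of one coefficient from an identity between polynomial functions known off the zeros
    of w. *)
Lemma sum_graded_eq0 (I : finType) (P : pred I) (c : I -> C) (e : I -> nat)
    (w : {poly C}) :
    w != 0 -> (forall s, w.[s] != 0 -> \sum_(i | P i) c i * s ^+ e i = 0) ->
  forall d, \sum_(i | P i && (e i == d)) c i = 0.
Proof.
move=> w_neq0 sum0 d; pose p : {poly C} := \sum_(i | P i) c i *: 'X^(e i).
have p0 : p = 0.
  apply: (poly_eq0_horner w_neq0) => s /sum0 <-; rewrite horner_sum.
  by apply: eq_bigr => i _; rewrite hornerZ hornerXn.
have p_d : p`_d = 0 by rewrite p0 coef0.
rewrite -[RHS]p_d coef_sum big_mkcondr; apply: eq_bigr => i _.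
by rewrite coefZ coefXn eq_sym; case: eqP; rewrite ?mulr1 ?mulr0.
Qed.

Section Independence.

Variables m n : nat.

(* (i, j, k, l) encodes the monomial x0^i x1^j x2^(m-i-j) y0^k y1^l y2^(n-k-l);
   those not divisible by x2 y2 form a basis of the bihomogeneous functions of
   bidegree (m, n) on the cone x0 y0 + x1 y1 + x2 y2 = 0. *)
Local Notation index := ('I_m.+1 * 'I_m.+1 * ('I_n.+1 * 'I_n.+1))%type.

Definition reduced_index : pred index := fun t =>
  [&& t.1.1 + t.1.2 <= m, t.2.1 + t.2.2 <= n &
      (t.1.1 + t.1.2 == m) || (t.2.1 + t.2.2 == n)]%N.

Definition index_monomial (x y : 'I_3 -> C) (t : index) : C :=
  bimonomial x y t.1.1 t.1.2 (m - t.1.1 - t.1.2)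
                 t.2.1 t.2.2 (n - t.2.1 - t.2.2).

(** It suffices to test on x = (X, 1, z) and y = (Y, 1, -(X Y + 1) / z), and to separate the
    exponents of z, Y and X in turn. *)
Lemma index_monomial_free (r : index -> C) :
    {in SL3 C, forall g, \sum_(t | reduced_index t)
       r t * index_monomial (xcol g) (ymin g) t = 0} ->
  forall t, reduced_index t -> r t = 0.
Proof.
move=> sum0 t0 Pt0.
pose a (t : index) := (m - t.1.1 - t.1.2)%N.
pose b (t : index) := (n - t.2.1 - t.2.2)%N.
(* The exponent of z after multiplication by z^n. On a reduced index a or b vanishes, so [e]
   determines both. *)
pose e (t : index) := (a t + (n - b t))%N.
have e_inj t : reduced_index t -> e t = e t0 -> a t = a t0 /\ b t = b t0.
  by move: Pt0; rewrite /reduced_index /e /a /b; lia.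
have step1 X Y : \sum_(t | reduced_index t && (e t == e t0))
    r t * X ^+ t.1.1 * Y ^+ t.2.1 * (- (X * Y + 1)) ^+ b t = 0.
  apply: (@sum_graded_eq0 _ _ _ _ 'X); first by rewrite polyX_eq0.
  move=> z; rewrite hornerX => z_neq0.
  (* The second column produces the required minors, the third the determinant 1. *)
  pose g : 'M[C]_3 := mx3 X z^-1 0 1 (- Y / z) 1 z 0 0.
  have SLg : g \in SL3 C by rewrite inE det_mx3; apply/eqP; field.
  rewrite -[RHS](mul0r (z ^+ n)) -[in RHS](sum0 g SLg) mulr_suml.
  apply: eq_bigr => t _.
  rewrite /index_monomial /bimonomial -/(a t) -/(b t).
  have -> : xcol g i0 = X by rewrite /xcol mxE.
  have -> : xcol g i1 = 1 by rewrite /xcol mxE.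
  have -> : xcol g i2 = z by rewrite /xcol mxE.
  have -> : ymin g i0 = Y by rewrite /ymin !mxE /=; field.
  have -> : ymin g i1 = 1 by rewrite /ymin !mxE /=; field.
  have -> : ymin g i2 = - (X * Y + 1) / z by rewrite /ymin !mxE /=; field.
  have def_n : n = (n - b t + b t)%N by rewrite /b; lia.
  rewrite [in z ^+ n]def_n /e !expr1n !exprMn exprVn !exprD.
  move: (expf_neq0 (b t) z_neq0); move: (z ^+ b t) (z ^+ (n - b t)) => S T S0.
  move: (_ ^+ b t) => U; by field.
(* Once [e] is fixed, b is constant and its factor cancels. *)
have step2 X Y : X * Y + 1 != 0 ->
    \sum_(t | reduced_index t && (e t == e t0)) r t * X ^+ t.1.1 * Y ^+ t.2.1 = 0.
  move=> XY; apply: (mulIf (expf_neq0 (b t0) (_ : - (X * Y + 1) != 0))).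
    by rewrite oppr_eq0.
  rewrite mul0r mulr_suml -[RHS](step1 X Y); apply: eq_bigr => t.
  by move=> /andP[Pt /eqP/(e_inj t Pt)[_ ->]].
have step3 X : \sum_(t | reduced_index t && (e t == e t0) &&
    (t.2.1 == t0.2.1 :> nat)) r t * X ^+ t.1.1 = 0.
  apply: (@sum_graded_eq0 _ _ _ _ (X *: 'X + 1)) => [|Y].
    apply/eqP => /(congr1 (fun p : {poly C} => p`_0))/eqP.
    by rewrite coefD coefZ coefX coefC coef0 mulr0 add0r oner_eq0.
  by rewrite !hornerE; apply: step2.
have := @sum_graded_eq0 _ _ r (fun t => t.1.1 : nat) 1 (oner_neq0 _)
  (fun X _ => step3 X) t0.1.1.
rewrite (bigD1 t0) ?Pt0 ?eqxx //= big1 ?addr0 // => t.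
move=> /andP[/andP[/andP[/andP[Pt /eqP et] /eqP kt] /eqP it]] /eqP[].
have [at0 bt0] := e_inj t Pt et.
move: t t0 Pt Pt0 at0 bt0 kt it {step1 step2 step3 et e_inj}.
move=> [[i j] [k l]] [[i' j'] [k' l']]; rewrite /reduced_index /a /b /=.
move=> Pt Pt0 at0 bt0 kt it; congr (_, _, (_, _)); apply: val_inj => /=; lia.
Qed.

End Independence.

End Monomials.

(** * The trace of a diagonal element *)

Section Irreducible.

Variables (C : numClosedFieldType) (pi : SL3_rep C).
Local Notation V := 'cV[C]_(SL3_dim pi).

(** A vector of S outside the current subspace is adjoined as long as there is one; the codimension
    bounds the number of rounds. *)
Lemma vspace_of_closed_pred (K : fieldType) (vT : vectType K) (S : vT -> Prop) :
    S 0 -> (forall a x y, S x -> S y -> S (a *: x + y)) ->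
  exists W : {vspace vT}, forall x, S x <-> x \in W.
Proof.
move=> S0 SD.
suff ext k (W : {vspace vT}) : (forall x, x \in W -> S x) ->
    (\dim {:vT} - \dim W <= k)%N -> exists W : {vspace vT}, forall x, S x <-> x \in W.
  by apply: (ext (\dim {:vT}) 0%VS) => [x|]; rewrite ?memv0 ?leq_subr // => /eqP->.
elim: k W => [|k IHk] W subW le_k.
  have /eqP defW : W == fullv by rewrite eqEdim subvf -subn_eq0 -leqn0.
  by exists W => x; split=> [_|/subW//]; rewrite defW memvf.
have [[x [Sx Wx]]|noS] := boolp.pselect (exists x, S x /\ x \notin W).
  apply: (IHk (W + <[x]>)%VS) => [y /memv_addP[u Wu [_ /vlineP[a ->] ->]]|].
    by rewrite addrC; apply: SD => //; apply: subW.
  have x_neq0 : x != 0 by apply: contraNneq Wx => ->; apply: mem0v.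
  rewrite dimv_disjoint_sum ?dim_vline ?x_neq0 ?addn1; first by lia.
  apply/eqP; rewrite -subv0; apply/subvP=> y; rewrite memv_cap memv0.
  case/andP=> Wy /vlineP[a def_y]; have [a0|a_neq0] := eqVneq a 0.
    by rewrite def_y a0 scale0r.
  by case/negP: Wx; rewrite -[x](scalerK a_neq0) -def_y memvZ.
exists W => x; split=> [Sx|/subW//]; apply: boolp.contrapT => /negP Wx.
by apply: noS; exists x.
Qed.

Hypothesis pi_irr : SL3_irreducible pi.

Lemma SL3_irreducible_pred (S : V -> Prop) :
    S 0 -> (forall a x y, S x -> S y -> S (a *: x + y)) ->
    {in SL3 C, forall g x, S x -> S (pi g *m x)} ->
  forall x0, x0 != 0 -> S x0 -> forall x, S x.
Proof.
move=> S0 SD Sg x0 x0_neq0 Sx0 x.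
have [W defW] := vspace_of_closed_pred S0 SD.
have W_stable : SL3_stable W.
  by move=> g SLg w Ww; apply/defW/Sg => //; apply/defW.
case: pi_irr => _ /(_ W W_stable)[W0|Wf]; last by apply/defW; rewrite Wf memvf.
by have /defW := Sx0; rewrite W0 memv0 (negPf x0_neq0).
Qed.

(** The vectors spanned by finitely many orbit points form a stable subspace containing v, hence
    everything; the lists obtained for the basis vectors are concatenated. *)
Lemma orbit_span (v : V) : v != 0 ->
  exists gs : seq 'M[C]_3, {subset gs <= SL3 C} /\
    forall x, x \in <<[seq pi g *m v | g <- gs]>>%VS.
Proof.
move=> v_neq0.
pose S x := exists gs : seq 'M[C]_3, {subset gs <= SL3 C} /\
  x \in <<[seq pi g *m v | g <- gs]>>%VS.
have allS : forall x, S x.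
  apply: (@SL3_irreducible_pred S _ _ _ v v_neq0).
  - by exists [::]; split=> //; apply: mem0v.
  - move=> a x y [gs [SLgs gs_x]] [hs [SLhs hs_y]]; exists (gs ++ hs); split.
      by move=> g; rewrite mem_cat => /orP[/SLgs|/SLhs].
    by rewrite map_cat span_cat memv_add // memvZ.
  - move=> h SLh x [gs [SLgs gs_x]]; exists [seq h *m g | g <- gs]; split.
      by move=> _ /mapP[g /SLgs SLg ->]; apply: SL3M.
    set X := [seq _ | g <- gs] in gs_x.
    rewrite (coord_span (X := in_tuple X) gs_x) mulmx_sumr memv_suml // => i _.
    rewrite -scalemxAr memvZ // memv_span //.
    have lt_i : (i < size gs)%N by rewrite -(size_map (fun g => pi g *m v)).
    rewrite /= (nth_map 0) // mulmxA -SL3_funM //; last by rewrite SLgs ?mem_nth.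
    by rewrite -map_comp; apply/mapP; exists (gs`_i); rewrite ?mem_nth.
  - exists [:: 1%:M]; split=> [g|]; first by rewrite inE => /eqP->; rewrite inE det1.
    by rewrite /= SL3_fun1 mul1mx memv_span ?mem_head.
have [hs def_hs] := fin_all_exists (fun i : 'I_(SL3_dim pi) => allS (delta_mx i 0)).
exists (flatten [seq hs i | i <- enum 'I_(SL3_dim pi)]); split.
  move=> g /flatten_mapP[i _ hs_g]; have [SLhs _] := def_hs i; exact: SLhs.
move=> x; rewrite [x]matrix_sum_delta memv_suml // => i _.
rewrite big_ord1 memvZ //; have [_] := def_hs i; apply/subvP/sub_span.
move=> y /mapP[g hs_g ->]; apply: map_f; apply/flatten_mapP.
by exists i; rewrite ?mem_enum.
Qed.

End Irreducible.

Section Trace.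

Variables (C : numClosedFieldType) (pi : SL3_rep C) (m n : nat).
Hypothesis pi_irr : SL3_irreducible pi.
Variable v : 'cV[C]_(SL3_dim pi).
Hypothesis v_neq0 : v != 0.
Variable phi : 'rV[C]_(SL3_dim pi).
Hypothesis phi_hw : {in SL3 C, forall g,
  (phi *m pi g *m v) 0 0 = hw_function m n g}.

Lemma SL3_1 : 1%:M \in SL3 C. Proof. by rewrite inE det1. Qed.

(** The vectors killed by all phi pi(h) form a stable subspace, and v is not among them since phi v
    = 1. *)
Lemma hw_functional_separates (x : 'cV[C]_(SL3_dim pi)) :
  {in SL3 C, forall h, (phi *m pi h *m x) 0 0 = 0} -> x = 0.
Proof.
move=> Sx; have [//|x_neq0] := eqVneq x 0.
pose S (y : 'cV[C]_(SL3_dim pi)) := {in SL3 C, forall h, (phi *m pi h *m y) 0 0 = 0}.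
have: S v; last first.
  move/(_ _ SL3_1); rewrite phi_hw ?SL3_1 // /hw_function /xcol /ymin !mxE /=.
  by rewrite !(mulr1, mul1r, mul0r, mulr0, subr0) !expr1n mul1r => /eqP; rewrite oner_eq0.
apply: (SL3_irreducible_pred pi_irr _ _ _ x_neq0 Sx) =>
  [h SLh|a y z Sy Sz h SLh|g SLg y Sy h SLh].
- by rewrite mulmx0 mxE.
- by rewrite mulmxDr -scalemxAr mxE mxE Sy // Sz // mulr0 addr0.
- by rewrite mulmxA -(mulmxA phi) -SL3_funM // Sy // SL3M.
Qed.

Section Relations.

Variables (I : finType) (c : I -> C) (g : I -> 'M[C]_3).
Hypothesis SLg : forall i, g i \in SL3 C.
Let x i := xcol (g i).
Let y i := ymin (g i).

Lemma hw_function_relation h : h \in SL3 C ->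
  \sum_i c i * hw_function m n (h *m g i) =
  (phi *m pi h *m (\sum_i c i *: (pi (g i) *m v) : 'cV_(SL3_dim pi))) 0 0.
Proof.
move=> SLh; rewrite mulmx_sumr summxE; apply: eq_bigr => i _.
rewrite -scalemxAr mxE mulmxA -(mulmxA phi) -SL3_funM // phi_hw //.
exact: SL3M.
Qed.

(* The kernel (g, h) |-> hw_function (g^* h) is positive: it is a Gram form. *)
Lemma orbit_relation_bimonomial :
    \sum_i c i *: (pi (g i) *m v) = 0 :> 'cV_(SL3_dim pi) ->
  forall a0 a1 a2 b0 b1 b2, (a0 + a1 + a2 = m)%N -> (b0 + b1 + b2 = n)%N ->
  \sum_i c i * bimonomial (x i) (y i) a0 a1 a2 b0 b1 b2 = 0.
Proof.
move=> rel0 a0 a1 a2 b0 b1 b2 def_m def_n.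
apply: gram_eq0_bimonomial; rewrite def_m def_n; apply: big1 => j _.
pose h := (map_mx Num.conj (g j))^T.
have SLh : h \in SL3 C.
  by rewrite SL3_tr // inE det_map_mx (eqP (SLg j)) rmorph1.
have := hw_function_relation SLh; rewrite rel0 mulmx0 [RHS]mxE => sum0.
transitivity ((c j)^* * \sum_k c k * hw_function m n (h *m g k)).
  rewrite mulr_sumr; apply: eq_bigr => k _; rewrite -mulrA; congr (_ * (_ * _)).
  rewrite hw_function_mul_tr; congr (_ ^+ _ * _ ^+ _).
    by apply: eq_bigr => i _; rewrite /x /xcol mxE.
  apply: eq_bigr => i _; congr (_ * _); rewrite /y /ymin !mxE.
  by apply: (@ord3P (fun i => _ (nth 0 _ i) = nth 0 _ i)) i;
    rewrite /= !(rmorphB, rmorphM).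
by rewrite sum0 mulr0.
Qed.

(** Converse to [orbit_relation_bimonomial]: each [hw_function m n (h *m g i)] is a product of
    powers of linear forms in x and y, hence a combination of monomials, and the cone equation
    reduces these. *)
Lemma reduced_relation_orbit :
    (forall t, reduced_index t -> \sum_i c i * @index_monomial C m n (x i) (y i) t = 0) ->
  \sum_i c i *: (pi (g i) *m v) = 0 :> 'cV_(SL3_dim pi).
Proof.
move=> red0; apply: hw_functional_separates => h SLh.
rewrite -hw_function_relation //.
rewrite (eq_bigr (fun i => c i * ((\sum_j xcol h^T j * x i j) ^+ m *
                                  (\sum_j ymin h^T j * y i j) ^+ n))).
  apply: bimonomial_eq0_hw; apply: bimonomial_eq0_reduced => [i|].
    exact: xcol_ymin.
  move=> a0 a1 a2 b0 b1 b2 def_m def_n ab0.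
  have lt_a0 : (a0 < m.+1)%N by lia. have lt_a1 : (a1 < m.+1)%N by lia.
  have lt_b0 : (b0 < n.+1)%N by lia. have lt_b1 : (b1 < n.+1)%N by lia.
  have := red0 (Ordinal lt_a0, Ordinal lt_a1, (Ordinal lt_b0, Ordinal lt_b1)).
  rewrite /reduced_index /index_monomial /=.
  have -> : (m - a0 - a1 = a2)%N by lia.
  have -> : (n - b0 - b1 = b2)%N by lia.
  by apply; lia.
by move=> i _; rewrite -hw_function_mul_tr trmxK.
Qed.

End Relations.

(** A matrix [K] is built that sends each pi(h) v to the values at h of the reduced monomials. It is
    invertible and conjugates pi(d) to the diagonal matrix of the monomial weights. *)
Lemma mxtrace_SL3_diag (d : 'rV[C]_3) : diag_mx d \in SL3 C ->
  \tr (pi (diag_mx d)) = \sum_(t | reduced_index t)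
    @index_monomial C m n (fun i => d 0 i) (fun i => (d 0 i)^-1) t.
Proof.
move=> SLd.
have [gs [SLgs span_gs]] := orbit_span pi_irr v_neq0.
pose N := size gs; pose g (k : 'I_N) := gs`_k.
have SLg k : g k \in SL3 C by apply: SLgs; rewrite mem_nth.
have span_g u : exists c : 'I_N -> C, u = \sum_k c k *: (pi (g k) *m v).
  pose X := in_tuple [seq pi g *m v | g <- gs].
  have eqN : size [seq pi g *m v | g <- gs] = N by rewrite size_map.
  exists (fun k => coord X (cast_ord (esym eqN) k) u).
  rewrite [LHS](coord_span (X := X) (span_gs u)).
  rewrite (reindex (cast_ord (esym eqN))) /=; last first.
    by exists (cast_ord eqN) => k _; rewrite ?cast_ordK ?cast_ordKV.
  by apply: eq_bigr => k _; rewrite (nth_map 0).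
pose mon h t := @index_monomial C m n (xcol h) (ymin h) t.
pose T := #|@reduced_index m n|.
pose B : 'M[C]_(SL3_dim pi, N) := \matrix_(i, k) (pi (g k) *m v) i 0.
pose Fm : 'M[C]_(T, N) := \matrix_(r, k) mon (g k) (enum_val r).
have colB k : col k B = pi (g k) *m v by apply/colP=> i; rewrite !mxE.
have reduced_val (r : 'I_T) : reduced_index (enum_val r) := enum_valP r.
have relP u h (c : 'I_N -> C) : h \in SL3 C -> u = pi h *m v ->
    u = \sum_k c k *: (pi (g k) *m v) ->
    forall t, reduced_index t -> mon h t = \sum_k c k * mon (g k) t.
  move=> SLh -> rel t; rewrite /reduced_index => Pt.
  (* The expression of pi(h) v is rewritten as a relation by adjoining h with coefficient -1. *)
  pose c' (k : 'I_1 + 'I_N) := if k is inr k then c k else -1.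
  pose g' (k : 'I_1 + 'I_N) := if k is inr k then g k else h.
  have SLg' k : g' k \in SL3 C by case: k => [k|k] /=.
  have: \sum_k c' k *: (pi (g' k) *m v) = 0 :> 'cV_(SL3_dim pi).
    by rewrite big_sumType big_ord1 /= -rel scaleN1r addNr.
  move/(orbit_relation_bimonomial SLg').
  move/(_ t.1.1 t.1.2 (m - t.1.1 - t.1.2)%N t.2.1 t.2.2 (n - t.2.1 - t.2.2)%N).
  rewrite big_sumType big_ord1 /= mulN1r => /(_ ltac:(lia) ltac:(lia)) /eqP.
  by rewrite addrC subr_eq0 eq_sym => /eqP.
(* Every relation between the columns of [B], the orbit vectors, holds between those of [Fm]; so
   [Fm] factors through [B]. *)
have Fm_B : (Fm <= B)%MS.
  rewrite submxE; apply/eqP/matrixP => r s; rewrite [RHS]mxE mxE.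
  set c := fun k => (cokermx B) k s.
  have /(orbit_relation_bimonomial SLg) rel0 :
      \sum_k c k *: (pi (g k) *m v) = 0 :> 'cV_(SL3_dim pi).
    have := mulmx_coker B => /(congr1 (col s)); rewrite col0 => e; rewrite -[RHS]e.
    apply/colP => i; rewrite summxE [RHS]mxE [RHS]mxE; apply: eq_bigr => k _.
    by rewrite mxE mulrC -colB [col k B _ _]mxE.
  under eq_bigr do rewrite mxE mulrC.
  have := reduced_val r; move: (enum_val r) => t; rewrite /reduced_index => Pt.
  by rewrite /mon /index_monomial; apply: rel0; lia.
pose K := Fm *m pinvmx B.
have K_B : K *m B = Fm by rewrite mulmxKpV.
have K_mon r h : h \in SL3 C -> (K *m (pi h *m v)) r 0 = mon h (enum_val r).
  move=> SLh; have [c def_c] := span_g (pi h *m v).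
  rewrite (relP _ _ _ SLh erefl def_c) // def_c mulmx_sumr summxE.
  apply: eq_bigr => k _; rewrite -scalemxAr mxE -colB colE mulmxA K_B -colE.
  by rewrite !mxE.
have K_free : row_free K.
  apply: inj_row_free => r rK0; apply/rowP => s; rewrite mxE.
  (* The row r, extended by zero from the enumerated reduced indices to all indices. *)
  pose r' t := \sum_(s | enum_val s == t) r 0 s.
  have r's : r' (enum_val s) = r 0 s.
    by apply: big_pred1 => s'; rewrite (inj_eq enum_val_inj).
  rewrite -r's; apply: index_monomial_free (reduced_val s) => h SLh.
  rewrite big_enum_val /=; transitivity ((r *m K *m (pi h *m v)) 0 0).
    rewrite -mulmxA mxE; apply: eq_bigr => s' _; rewrite K_mon //; congr (_ * _).
    by apply: big_pred1 => s''; rewrite (inj_eq enum_val_inj).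
  by rewrite rK0 mul0mx mxE.
(* A vector killed by [K] is a combination of orbit vectors whose coefficients satisfy all reduced
   relations, hence zero. *)
have K_full : row_full K.
  rewrite /row_full -mxrank_tr -/(row_free K^T).
  apply: inj_row_free => u uK0; apply: trmx_inj.
  rewrite trmx0; have {uK0} Ku0 : K *m u^T = 0.
    by apply: trmx_inj; rewrite trmx_mul trmxK uK0 trmx0.
  have [c def_c] := span_g u^T; rewrite def_c in Ku0 *.
  apply: (reduced_relation_orbit SLg) => t Pt.
  have in_t : t \in @reduced_index m n by [].
  move/matrixP/(_ (enum_rank_in in_t t) 0): Ku0; rewrite [RHS]mxE.
  rewrite mulmx_sumr summxE => sum0; rewrite -[RHS]sum0.
  by apply: eq_bigr => k _; rewrite -scalemxAr mxE K_mon // enum_rankK_in.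
have B_free : row_free B.
  apply: inj_row_free => u uB0; apply/rowP => i; rewrite [RHS]mxE.
  have [c def_c] := span_g (delta_mx i 0).
  transitivity ((u *m delta_mx i 0 : 'M_1) 0 0); first by rewrite -colE mxE.
  rewrite def_c mulmx_sumr summxE big1 // => k _.
  by rewrite -scalemxAr -colB colE mulmxA uB0 mul0mx !mxE mulr0.
pose w t := @index_monomial C m n (fun i => d 0 i) (fun i => (d 0 i)^-1) t.
pose D := diag_mx (\row_(r < T) w (enum_val r)).
have mon_diag h t : mon (diag_mx d *m h) t = w t * mon h t.
  have d_prod : d 0 i0 * d 0 i1 * d 0 i2 = 1.
    move: SLd; rewrite inE det_diag => /eqP <-.
    rewrite !big_ord_recl big_ord0 mulr1 mulrA; congr (_ * d 0 _).
    exact: val_inj.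
  have x_d i : xcol (diag_mx d *m h) i = d 0 i * xcol h i.
    by rewrite /xcol mul_diag_mx mxE.
  have d_neq0 i : d 0 i != 0.
    have: d 0 i0 * d 0 i1 * d 0 i2 != 0 by rewrite d_prod oner_eq0.
    rewrite !mulf_eq0 !negb_or -andbA => /and3P[? ? ?].
    by apply: (@ord3P (fun i => d 0 i != 0)) i.
  (* As d0 d1 d2 = 1, the product of two diagonal entries is the inverse of the third. *)
  have y_d i : ymin (diag_mx d *m h) i = (d 0 i)^-1 * ymin h i.
    apply: (mulfI (d_neq0 i)); rewrite mulVKf // -[RHS]mul1r -d_prod.
    rewrite /ymin mul_diag_mx !mxE; apply: (@ord3P (fun i => d 0 i * nth 0 _ i =
      _ * nth 0 _ i)) i => /=; ring.
  rewrite /mon /w /index_monomial /bimonomial !x_d !y_d !exprMn; ring.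
(* The columns of [B] span, so it is enough to compare both sides on orbit vectors. *)
have K_pi : K *m pi (diag_mx d) = D *m K.
  apply: (row_free_inj B_free); rewrite -[RHS]mulmxA K_B.
  apply/matrixP => r k; transitivity ((K *m pi (diag_mx d) *m col k B) r 0).
    by rewrite colE mulmxA -colE [RHS]mxE.
  rewrite colB -mulmxA [X in (K *m X) r 0]mulmxA -SL3_funM // K_mon ?SL3M //.
  by rewrite mon_diag mul_diag_mx !mxE.
rewrite -[pi _]mul1mx -(mulVpmx K_full) -mulmxA K_pi mulmxA mxtrace_mulC.
rewrite mulmxA mulmxVp // mul1mx /mxtrace.
rewrite [RHS]big_enum_val; apply: eq_bigr => r _.
by rewrite !mxE eqxx.
Qed.

End Trace.

(** * Weight sums as complete symmetric polynomials *)

Section CharacterSeries.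

Variable F : fieldType.

Lemma complete_sym_cons (a : F) s n :
  complete_sym (a :: s) n = \sum_(i < n.+1) a ^+ i * complete_sym s (n - i).
Proof. by []. Qed.

Lemma complete_sym1 (a : F) n : complete_sym [:: a] n = a ^+ n.
Proof.
rewrite /= big_ord_recr /= subnn mulr1 big1 ?add0r // => i _.
by rewrite subn_eq0 leqNgt ltn_ord mulr0.
Qed.

Lemma complete_sym2 (a b : F) n :
  complete_sym [:: a; b] n = \sum_(i < n.+1) a ^+ i * b ^+ (n - i).
Proof.
by rewrite complete_sym_cons; apply: eq_bigr => i _; rewrite complete_sym1.
Qed.

(** Here c has exponent 0; it is displayed so that the summand matches that of [sum_pairs]. *)
Lemma sum_top_pairs (a b c : F) m :
  \sum_(p : 'I_m.+1 * 'I_m.+1 | (p.1 + p.2 == m)%N)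
    a ^+ p.1 * b ^+ p.2 * c ^+ (m - p.1 - p.2) = complete_sym [:: a; b] m.
Proof.
rewrite complete_sym2 -(pair_big_dep xpredT (fun i j : 'I_m.+1 => i + j == m)%N
  (fun i j : 'I_m.+1 => a ^+ i * b ^+ j * c ^+ (m - i - j))) /=.
apply: eq_bigr => i _; rewrite (big_pred1 (rev_ord i)) /= => [|j].
  by rewrite subSS subnn expr0 mulr1.
have lt_im := ltn_ord i; apply/eqP/eqP => [def_m|->]; last by rewrite /=; lia.
by apply: val_inj => /=; lia.
Qed.

Lemma sum_pairs (a b c : F) m :
  \sum_(p : 'I_m.+1 * 'I_m.+1 | (p.1 + p.2 <= m)%N)
    a ^+ p.1 * b ^+ p.2 * c ^+ (m - p.1 - p.2) = complete_sym [:: a; b; c] m.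
Proof.
rewrite -(pair_big_dep xpredT (fun i j : 'I_m.+1 => i + j <= m)%N
  (fun i j : 'I_m.+1 => a ^+ i * b ^+ j * c ^+ (m - i - j))).
rewrite complete_sym_cons; apply: eq_bigr => i _.
rewrite complete_sym2 mulr_sumr.
rewrite (big_ord_widen m.+1 (fun j => a ^+ i * (b ^+ j * c ^+ (m - i - j)))).
  apply: eq_big => [j|j _]; last by rewrite mulrA.
  by have := ltn_ord i; lia.
by rewrite ltnS leq_subr.
Qed.

Lemma sum_prodType (I J : finType) (f : I -> F) (g : J -> F) :
  \sum_(t : I * J) f t.1 * g t.2 = (\sum_i f i) * (\sum_j g j).
Proof. by rewrite big_distrlr /= pair_big. Qed.

(** Inclusion-exclusion: inside A x B, the union of A' x B and A x B' has intersection A' x B'. *)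
Lemma sum_prodType_union (I J : finType) (A A' : pred I) (B B' : pred J)
    (f : I -> F) (g : J -> F) :
    subpred A' A -> subpred B' B ->
  \sum_(t : I * J | [&& A t.1, B t.2 & A' t.1 || B' t.2]) f t.1 * g t.2 =
  (\sum_(i | A i) f i) * (\sum_(j | B' j) g j) +
  (\sum_(i | A' i) f i) * (\sum_(j | B j) g j) -
  (\sum_(i | A' i) f i) * (\sum_(j | B' j) g j).
Proof.
move=> subA subB.
rewrite big_mkcond (big_mkcond A) (big_mkcond A') (big_mkcond B) (big_mkcond B').
rewrite -!sum_prodType -big_split -sumrB; apply: eq_bigr => t _ /=.
have := subA t.1; have := subB t.2.
by case: (A t.1); case: (A' t.1); case: (B t.2); case: (B' t.2) => /= hB hA;
  first [by have := hB isT | by have := hA isT | ring].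
Qed.

End CharacterSeries.

Section ReducedSum.

Variable C : numClosedFieldType.

(** A reduced monomial lacks x2 or lacks y2; the subtracted term counts those lacking both. *)
Lemma sum_reduced_index (x y : 'I_3 -> C) m n :
  \sum_(t | @reduced_index m n t) index_monomial x y t =
  complete_sym [:: x i0; x i1; x i2] m * complete_sym [:: y i0; y i1] n +
  complete_sym [:: x i0; x i1] m * complete_sym [:: y i0; y i1; y i2] n -
  complete_sym [:: x i0; x i1] m * complete_sym [:: y i0; y i1] n.
Proof.
rewrite -!sum_pairs -(sum_top_pairs (x i0) _ (x i2)).
rewrite -(sum_top_pairs (y i0) _ (y i2)).
apply: (@sum_prodType_union C ('I_m.+1 * 'I_m.+1)%type ('I_n.+1 * 'I_n.+1)%type
  (fun p => (p.1 + p.2 <= m)%N)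
  (fun p => (p.1 + p.2 == m)%N) (fun p => (p.1 + p.2 <= n)%N)
  (fun p => (p.1 + p.2 == n)%N)
  (fun p : 'I_m.+1 * 'I_m.+1 =>
    x i0 ^+ p.1 * x i1 ^+ p.2 * x i2 ^+ (m - p.1 - p.2))
  (fun p : 'I_n.+1 * 'I_n.+1 =>
    y i0 ^+ p.1 * y i1 ^+ p.2 * y i2 ^+ (n - p.1 - p.2)));
  by move=> p /eqP->.
Qed.

Lemma reduced_sum_rational (x y : 'I_3 -> C) :
  rational_series (fun m n => \sum_(t | @reduced_index m n t) index_monomial x y t).
Proof.
have rat s s' := complete_sym_rational (F := C) s s'.
apply: eq_rational_series (rational_seriesD (rational_seriesD
  (rat [:: x i0; x i1; x i2] [:: y i0; y i1])
  (rat [:: x i0; x i1] [:: y i0; y i1; y i2]))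
  (rational_seriesZ (-1) (rat [:: x i0; x i1] [:: y i0; y i1]))) => m n.
by rewrite sum_reduced_index mulN1r.
Qed.

Lemma mxtrace_SL3_highest_weight (pi : SL3_rep C) m n (d : 'rV[C]_3) :
    SL3_irreducible pi -> has_highest_weight pi m n -> diag_mx d \in SL3 C ->
  \tr (pi (diag_mx d)) = \sum_(t | @reduced_index m n t)
    index_monomial (fun i => d 0 i) (fun i => (d 0 i)^-1) t.
Proof.
move=> pi_irr [v [v_neq0 v_unip v_diag]] SLd.
have [phi phi_hw] := hw_functional v_neq0 v_unip v_diag.
exact: (mxtrace_SL3_diag pi_irr v_neq0 phi_hw SLd).
Qed.

Lemma mxtrace_SL3_conj (pi : SL3_rep C) (A S D : 'M[C]_3) :
    A \in SL3 C -> S \in SL3 C -> A *m S = S *m D ->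
  D \in SL3 C /\ \tr (pi A) = \tr (pi D).
Proof.
move=> SLA SLS AS_SD; have uS : S \in unitmx.
  by rewrite unitmxE (eqP SLS) unitr1.
have SLS' : invmx S \in SL3 C by rewrite inE det_inv (eqP SLS) invr1.
have def_D : D = invmx S *m (A *m S) by rewrite AS_SD mulKmx.
have SLD : D \in SL3 C by rewrite def_D !SL3M.
split=> //; rewrite def_D !SL3_funM ?SL3M // mxtrace_mulC -mulmxA -SL3_funM //.
by rewrite mulmxV // SL3_fun1 mulmx1.
Qed.

Lemma mxtrace_SL3_restr_rational (gT : finGroupType) (G : {group gT})
    (iota : mx_representation C G 3) (iota_SL3 : {in G, forall x, iota x \in SL3 C})
    (pi : nat -> nat -> SL3_rep C) :
    (forall m n, SL3_irreducible (pi m n)) ->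
    (forall m n, has_highest_weight (pi m n) m n) ->
  forall x, x \in G -> rational_series (fun m n => \tr (SL3_restr iota_SL3 (pi m n) x)).
Proof.
move=> pi_irr pi_hw x Gx.
(* The eigenvalues [d] depend on x alone, so one series serves for all (m, n). *)
have [S SLS [d def_d]] := diagonalizable_SL3 (diagonalizable_repr iota Gx).
apply: eq_rational_series (reduced_sum_rational (fun i => d 0 i)
  (fun i => (d 0 i)^-1)) => m n.
have [SLd ->] := mxtrace_SL3_conj (pi m n) (iota_SL3 x Gx) SLS def_d.
by rewrite (mxtrace_SL3_highest_weight (pi_irr m n) (pi_hw m n)).
Qed.

End ReducedSum.

(** * The multiplicity series *)

Lemma coord_P_series (F : fieldType) l (mult : nat -> nat -> 'I_l.+1 -> nat) i m n :
  coord_series (P_series F mult) i m n = (mult m n i)%:R.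
Proof.
rewrite /coord_series /P_series /mult_vector summxE (bigD1 i) //= big1 ?addr0.
  by rewrite !mxE !eqxx mulr1.
by move=> j /negPf ne_ji; rewrite !mxE [i == j]eq_sym ne_ji andbF mulr0.
Qed.

Theorem proposition6 (R : realType)
    (gT : finGroupType) (Gamma : {group gT})
    (iota : mx_representation R[i] Gamma 3)
    (iota_faithful : mx_faithful iota)
    (iota_SL3 : {in Gamma, forall x, iota x \in SL3 R[i]})
    (l : nat) (gamma : 'I_l.+1 -> representation R[i] Gamma)
    (gamma_irr : irr_representatives gamma)
    (gamma0_trivial : trivial_representation (gamma ord0))
    (pi : nat -> nat -> SL3_rep R[i])
    (pi_irr : forall m n, SL3_irreducible (pi m n))
    (pi_weight : forall m n, has_highest_weight (pi m n) m n)
    (mult : nat -> nat -> 'I_l.+1 -> nat)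
    (mult_def : forall m n,
       mx_rsim (SL3_restr iota_SL3 (pi m n)) (isotypic_sum gamma (mult m n))) :
  forall i : 'I_l.+1, rational_series (coord_series (P_series R[i] mult) i).
Proof.
move=> i; have [c def_c] := @multiplicity_mxtrace R[i] _ _ _ _ i gamma_irr.
pose f x m n := c x * \tr (SL3_restr iota_SL3 (pi m n) x).
apply: (@eq_rational_series _ (fun m n => \sum_(x in Gamma) f x m n)) => [m n|].
  by rewrite coord_P_series (def_c _ _ _ (mult_def m n)).
apply: rational_series_sum => x Gx; apply: rational_seriesZ.
exact: (@mxtrace_SL3_restr_rational R[i] _ _ _ iota_SL3 pi pi_irr pi_weight x Gx).
Qed.
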